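(* $$\frac{1}{1-t}+\sum_{n=1}^\infty\frac{(1+t^2)^n}{2(1-t)^2(1-t^2)^{n-1}}F_n^{\mathrm{udr}}\left(\frac{2t}{1+t^2},z_1,z_2,\dots\right)x^n$$ $$=\sum_{k=0}^\infty t^{2k}\prod_{i=1}^\infty\left(\frac{1+z_ix^i}{1-z_ix^i}\right)^{g_{i,k}}+\sum_{k=0}^\infty\frac{t^{2k+1}}{1-z_1x}\prod_{i=1}^\infty\left(\frac{1+z_ix^i}{1-z_ix^i}\right)^{h_{i,k}}.$$
   Context: For a permutation $\pi=\pi(1)\cdots\pi(n)$ of $[n]=\{1,\dots,n\}$, a birun is a maximal monotone consecutive subsequence of $\pi$, and an up-down run is a birun of $\pi$, or the single letter $\pi(1)$ if $\pi(1)>\pi(2)$; $\mathrm{udr}(\pi)$ is the number of up-down runs (equal to $1$ for the permutation of length $1$; e.g. $71462853$ has up-down runs $7,71,146,62,28,853$). $N_i(\pi)$ is the number of cycles of length $i$ of $\pi$, and $\mathfrak{S}_n$ is the set of all permutations of $[n]$. With variables $z_1,z_2,\dots$, put $$F_n^{\mathrm{udr}}(t,z_1,z_2,\dots)=\sum_{\pi\in\mathfrak{S}_n}t^{\mathrm{udr}(\pi)}\prod_{i=1}^\infty z_i^{N_i(\pi)}.$$ Also $$g_{i,k}=\frac1{2i}\sum_{\substack{d\mid i\\ d\text{ odd}}}\mu(d)(2k)^{i/d},\qquad h_{i,k}=\begin{cases}\dfrac{(1+2k)^i-1}{2i},&\text{if }i=2^j\text{ with }j\ge0,\\[2mm]\dfrac1{2i}\displaystyle\sum_{\substack{d\mid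 i\\ d\text{ odd}}}\mu(d)(1+2k)^{i/d},&\text{otherwise,}\end{cases}$$ where $\mu$ is the number-theoretic Möbius function. The identity is between formal power series in $x$ and $t$; rational functions of $t$ are expanded as power series in $t$. *)

(* Defs.v *)
From HB Require Import structures.
From mathcomp Require Import all_boot all_order all_fingroup all_algebra.
From mathcomp Require Import boolp classical_sets.
From mathcomp.multinomials Require Import monalg.

Set Implicit Arguments.
Unset Strict Implicit.
Unset Printing Implicit Defensive.

Import GRing.Theory Num.Theory.
Local Open Scope ring_scope.

Reserved Notation "\sumoo_ ( m <= i ) F"
  (at level 41, F at level 41, m at level 50, i at level 50,
   format "'[' \sumoo_ ( m  <=  i ) '/  '  F ']'").
Reserved Notation "\prodoo_ ( m <= i ) F"
  (at level 36, F at level 36, m at level 50, i at level 50,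
   format "'[' \prodoo_ ( m  <=  i ) '/  '  F ']'").

(******************************************************************************)
(* Formal power series over a commutative ring R: fps R is R[[X]], and        *)
(* f n is the coefficient of X^n in f.                                        *)
(******************************************************************************)

Record fps (R : Type) := FPS { coefs :> nat -> R }.

HB.instance Definition _ (R : Type) := gen_eqMixin (fps R).
HB.instance Definition _ (R : Type) := gen_choiceMixin (fps R).

Lemma fpsP (R : Type) (f g : fps R) : f =1 g -> f = g.
Proof. by case: f g => [f] [g] /= /funext ->. Qed.

Section FpsZmodule.
Variable R : zmodType.
Implicit Types f g : fps R.

Definition fps_zero : fps R := FPS (fun=> 0).
Definition fps_opp f := FPS (fun n => - f n).
Definition fps_add f g := FPS (fun n => f n + g n).

Fact fps_addA : associative fps_add.
Proof. by move=> f g h; apply: fpsP => n /=; rewrite addrA. Qed.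
Fact fps_addC : commutative fps_add.
Proof. by move=> f g; apply: fpsP => n /=; rewrite addrC. Qed.
Fact fps_add0 : left_id fps_zero fps_add.
Proof. by move=> f; apply: fpsP => n /=; rewrite add0r. Qed.
Fact fps_addN : left_inverse fps_zero fps_opp fps_add.
Proof. by move=> f; apply: fpsP => n /=; rewrite addNr. Qed.

HB.instance Definition _ :=
  GRing.isZmodule.Build (fps R) fps_addA fps_addC fps_add0 fps_addN.

End FpsZmodule.

Section FpsRing.
Variable R : comNzRingType.
Implicit Types (f g : fps R) (c : R).

Definition fpsC c : fps R := FPS (fun n => if n == 0%N then c else 0).
Definition fpsX : fps R := FPS (fun n => (n == 1)%:R).

Definition fps_mul f g : fps R :=
  FPS (fun n => \sum_(i < n.+1) f i * g (n - i)%N).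

Definition trunc n f : {poly R} := \poly_(i < n) f i.

Fact fps_mul_trunc N f g n : (n < N)%N ->
  fps_mul f g n = (trunc N f * trunc N g)`_n.
Proof.
move=> ltnN; rewrite coefM /=; apply: eq_bigr => i _.
by rewrite !coef_poly !(leq_ltn_trans _ ltnN) ?leq_subr // -ltnS.
Qed.

Fact fps_mulA : associative fps_mul.
Proof.
move=> f g h; apply: fpsP => n.
transitivity (trunc n.+1 f * (trunc n.+1 g * trunc n.+1 h))`_n.
  rewrite (@fps_mul_trunc n.+1) // !coefM; apply: eq_bigr => i _; congr (_ * _).
  by rewrite coef_poly ltnS leq_subr (@fps_mul_trunc n.+1) // ltnS leq_subr.
rewrite mulrA (@fps_mul_trunc n.+1) // !coefM; apply: eq_bigr => i _.
by congr (_ * _); rewrite coef_poly ltn_ord (@fps_mul_trunc n.+1).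
Qed.

Fact fps_mulC : commutative fps_mul.
Proof.
by move=> f g; apply: fpsP => n; rewrite !(@fps_mul_trunc n.+1) // mulrC.
Qed.

Fact fps_mul1 : left_id (fpsC 1) fps_mul.
Proof.
move=> f; apply: fpsP => n; rewrite /= big_ord_recl /= mul1r subn0.
by rewrite big1 ?addr0 // => i _; rewrite mul0r.
Qed.

Fact fps_mulDl : left_distributive fps_mul +%R.
Proof.
move=> f g h; apply: fpsP => n /=; rewrite -big_split /=.
by apply: eq_bigr => i _; rewrite mulrDl.
Qed.

Fact fps_oner_neq0 : fpsC 1 != 0.
Proof.
apply/eqP => /(congr1 (fun f : fps R => f 0%N)) /= /eqP.
by rewrite oner_eq0.
Qed.

HB.instance Definition _ := GRing.Zmodule_isComNzRing.Build (fps R)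
  fps_mulA fps_mulC fps_mul1 fps_mulDl fps_oner_neq0.

(* R is not assumed to have computable inverses, hence the classical          *)
(* definition; fps_unitP below is the usual criterion.                        *)
Definition fps_unit : pred (fps R) := fun f => `[< exists g, g * f = 1 >].
Definition fps_inv f : fps R := xget f [set g | g * f = 1].

Fact fps_mulVr : {in fps_unit, left_inverse 1 fps_inv *%R}.
Proof. by move=> f /asboolP fU; have := xgetPex f fU. Qed.
Fact fps_unitPl f g : g * f = 1 -> fps_unit f.
Proof. by move=> gf1; apply/asboolP; exists g. Qed.
Fact fps_inv_out : {in [predC fps_unit], fps_inv =1 id}.
Proof.
move=> f /= fNU; apply: xgetPN => g gf1.
by case/negP: fNU; apply/asboolP; exists g.
Qed.

HB.instance Definition _ := GRing.ComNzRing_hasMulInverse.Build (fps R)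
  fps_mulVr fps_unitPl fps_inv_out.

Fixpoint fps_invs (c : R) (f : fps R) n : seq R :=
  if n is n'.+1 then
    let s := fps_invs c f n' in
    rcons s (c * ((n' == 0%N)%:R - \sum_(i < n') s`_i * f (n' - i)%N))
  else [::].

Lemma fps_unitP f :
  reflect (exists c, c * f 0%N = 1) (f \is a GRing.unit).
Proof.
apply: (iffP idP) => [fU | [c cf0]].
  exists (f^-1 0%N).
  have := congr1 (fun h : fps R => h 0%N) (mulVr fU).
  by rewrite /= big_ord_recl big_ord0 /= addr0 subn0.
have szs n : size (fps_invs c f n) = n by elim: n => //= n IH; rewrite size_rcons IH.
have nths n m : (n < m)%N -> (fps_invs c f m)`_n = (fps_invs c f n.+1)`_n.
  elim: m => // m IH; rewrite ltnS leq_eqVlt => /predU1P[-> // | ltnm].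
  by rewrite -IH //= nth_rcons szs ltnm.
apply/asboolP; exists (FPS (fun n => (fps_invs c f n.+1)`_n)).
apply: fpsP => n /=; rewrite big_ord_recr /= nth_rcons szs ltnn eqxx subnn.
rewrite mulrAC cf0 mul1r addrC.
have -> : (n == 0%N)%:R = (1 : fps R) n by case: n.
rewrite -[RHS](subrK (\sum_(i < n) (fps_invs c f n)`_i * f (n - i)%N)).
by congr (_ + _); apply: eq_bigr => i _; rewrite [in RHS](nths i n).
Qed.

End FpsRing.

(******************************************************************************)
(* Series in two variables, R[[x, t]] = R[[t]][[x]]: f n m is the coefficient *)
(* of x^n t^m. A sequence of such series converges when each coefficient is   *)
(* eventually constant; psseq_lim is then the limit.                          *)
(******************************************************************************)

Definition eventual_value (T : choiceType) (x0 : T) (u : nat -> T) : T :=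
  xget x0 [set c | exists N, forall n, (N <= n)%N -> u n = c].

Lemma eventual_valueE (T : choiceType) (x0 : T) (u : nat -> T) c N :
  (forall n, (N <= n)%N -> u n = c) -> eventual_value x0 u = c.
Proof.
move=> uc; apply: xget_unique; first by exists N.
move=> d [M ud]; rewrite -(uc (maxn M N)) ?leq_maxr //.
by rewrite ud ?leq_maxl.
Qed.

Section Bivariate.
Variable R : comNzRingType.
Local Notation A := (fps (fps R)).

Definition psseq_lim (u : nat -> A) : A :=
  FPS (fun n => FPS (fun m => eventual_value 0 (fun N => u N n m))).

Definition pssum (m : nat) (u : nat -> A) : A :=
  psseq_lim (fun N => \sum_(m <= i < N) u i).

Definition psprod (m : nat) (u : nat -> A) : A :=
  psseq_lim (fun N => \prod_(m <= i < N) u i).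

End Bivariate.

Notation "\sumoo_ ( m <= i ) F" := (pssum m (fun i => F)) : ring_scope.
Notation "\prodoo_ ( m <= i ) F" := (psprod m (fun i => F)) : ring_scope.

Definition binomq (a : rat) (m : nat) : rat :=
  (\prod_(j < m) (a - j%:R)) / (m`!)%:R.

(* f ^ a for a rational exponent a and a series f with constant term 1, by    *)
(* the binomial series. ratr is meaningful when positive integers are         *)
(* invertible in R; for the ring used below see psring_natr_unit.             *)
Definition pspow (R : comNzRingType) (f : fps (fps R)) (a : rat) : fps (fps R) :=
  \sumoo_(0 <= m) (ratr (binomq a m) * (f - 1) ^+ m).

Lemma binomq_nat (n m : nat) : binomq n%:R m = 'C(n, m)%:R.
Proof.
rewrite /binomq; apply: (canLR (mulfK _)).
  by rewrite pnatr_eq0 -lt0n fact_gt0.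
rewrite -natrM bin_ffact ffact_prod natr_prod.
have [le_mn | lt_nm] := leqP m n.
  apply: eq_bigr => j _; rewrite natrB //.
  exact: leq_trans (ltnW (ltn_ord j)) le_mn.
rewrite (bigD1 (Ordinal lt_nm)) //= subrr mul0r.
by rewrite (bigD1 (Ordinal lt_nm)) //= subnn mul0r.
Qed.

Lemma pspow_nat (R : comNzRingType) (f : fps (fps R)) (n : nat) :
  pspow f n%:R = f ^+ n.
Proof.
apply: fpsP => i; apply: fpsP => j /=.
apply: (@eventual_valueE _ _ _ _ n.+1) => N ltnN.
congr (coefs (coefs _ i) j).
rewrite big_mkord -{2}[f](subrK 1) exprDn.
rewrite -(big_mkord xpredT (fun m =>
  (f - 1) ^+ (n - m) * 1 ^+ m *+ 'C(n, m))) big_nat_rev /=.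
rewrite big_mkord (big_ord_widen _ (fun m =>
  (f - 1) ^+ (n - (0 + n.+1 - m.+1)) * 1 ^+ (0 + n.+1 - m.+1)
    *+ 'C(n, 0 + n.+1 - m.+1)) ltnN) [RHS]big_mkcond /=.
apply: eq_bigr => m _; rewrite binomq_nat ratr_nat add0n subSS expr1n mulr1.
rewrite mulr_natl ltnS; case: leqP => [le_mn | lt_nm].
  by rewrite subKn // bin_sub.
by rewrite bin_small.
Qed.

(******************************************************************************)
(* Polynomials over rat in infinitely many variables z_0, z_1, z_2, ... are   *)
(* the monoid algebra of the free commutative monoid on nat (z_0 is unused).  *)
(******************************************************************************)

Notation polyz := {malg rat[{cmonom nat}]}.
Notation psring := (fps (fps polyz)).

Lemma psring_natr_unit (n : nat) : n.+1%:R \is a @GRing.unit psring.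
Proof.
have natrE (S : comNzRingType) m : (m%:R : fps S) 0%N = m%:R.
  by elim: m => // m IH; rewrite !mulrS -IH.
have natr_inv : (n.+1%:R^-1 : rat)%:A * n.+1%:R = 1 :> polyz.
  by rewrite -scalerAl mul1r -scaler_nat scalerA mulVf ?scale1r // pnatr_eq0.
have nU : n.+1%:R \is a @GRing.unit (fps polyz).
  by apply/fps_unitP; exists (n.+1%:R^-1 : rat)%:A; rewrite natrE.
by apply/fps_unitP; exists n.+1%:R^-1; rewrite natrE mulVr.
Qed.

Definition ps_z (i : nat) : psring := fpsC (fpsC (<< 1 *g ucm i >>)).
Definition ps_t : psring := fpsC (fpsX polyz).
Definition ps_x : psring := fpsX (fps polyz).

(******************************************************************************)
(* A consecutive subsequence of w is given by the pair (i, j), i <= j, of its *)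
(* first and last (0-based) positions. A birun of a word with at least two    *)
(* letters has at least two letters, so (0, 0) is never counted twice.        *)
(******************************************************************************)

Section UpDownRuns.
Implicit Types (w : seq nat) (p q : nat * nat).

Definition intervals n : seq (nat * nat) :=
  [seq p <- [seq (i, j) | i <- iota 0 n, j <- iota 0 n] | (p.1 <= p.2)%N].

Definition subword w p := drop p.1 (take p.2.+1 w).

Definition monotone w := sorted ltn w || sorted gtn w.

Definition is_birun w p :=
  monotone (subword w p) &&
  all (fun q => [&& (q.1 <= p.1)%N, (p.2 <= q.2)%N & monotone (subword w q)]
                ==> (q == p))
      (intervals (size w)).

Definition is_updown_run w p :=
  is_birun w p || [&& (1 < size w)%N, p == (0, 0)%N & (nth 0 w 1 < nth 0 w 0)%N].

Definition udr_word w := count (is_updown_run w) (intervals (size w)).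

End UpDownRuns.

Example udr_71462853 : udr_word [:: 7; 1; 4; 6; 2; 8; 5; 3]%N = 6%N.
Proof. by []. Qed.

Section Permutations.
Variables (n : nat) (s : 'S_n).

Definition word_of_perm : seq nat := [seq (s i).+1 | i : 'I_n].
Definition udr : nat := udr_word word_of_perm.
Definition ncycles (i : nat) : nat := #|[set C in porbits s | #|C| == i]|.

End Permutations.

(* F_n^udr (t, z_1, z_2, ...), evaluated at elements t and z_i of a           *)
(* commutative ring; no cycle of s is longer than n.                          *)
Definition Fudr (A : comNzRingType) (n : nat) (t : A) (z : nat -> A) : A :=
  \sum_(s : 'S_n) t ^+ udr s * \prod_(1 <= i < n.+1) z i ^+ ncycles s i.

Definition moebius (d : nat) : int :=
  if all (fun p => logn p d == 1%N) (primes d) then (-1) ^+ size (primes d)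
  else 0.

(* The bound on j is harmless since j < 2 ^ j. *)
Definition is_pow2 (i : nat) : bool := [exists j : 'I_i, i == (2 ^ j)%N].

Definition g_exp (i k : nat) : rat :=
  (2 * i)%:R^-1 *
  \sum_(d <- divisors i | odd d) (moebius d)%:~R * ((2 * k) ^ (i %/ d))%:R.

Definition h_exp (i k : nat) : rat :=
  if is_pow2 i then (((1 + 2 * k) ^ i)%:R - 1) / (2 * i)%:R
  else (2 * i)%:R^-1 *
    \sum_(d <- divisors i | odd d) (moebius d)%:~R * ((1 + 2 * k) ^ (i %/ d))%:R.

(* Main.v *)
From HB Require Import structures.
Require Import Defs.
From mathcomp Require Import all_boot all_order all_fingroup all_algebra.
From mathcomp.multinomials Require Import monalg.
From mathcomp Require Import zify ring.

Set Implicit Arguments.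
Unset Strict Implicit.
Unset Printing Implicit Defensive.

Import GRing.Theory Num.Theory.

(** For a permutation s of n points and a number m, call f : 'I_n -> 'I_m
    a compatible labelling of s if f is weakly increasing along the
    positions and s increases on the positions with a given even label and
    decreases on those with a given odd label. Equivalently, s is cut into
    m consecutive segments, possibly empty, alternately increasing and
    decreasing, the first one increasing. Both sides of the identity have
    the same coefficient of x^n t^m, namely labelled_sum n m: the sum of
    the cycle weights of s over all compatible pairs (s, f).

    On the left-hand side, compatible labellings of a fixed s are counted
    by a transfer argument on the last label. In generating functions over
    m, a step between neighbours contributes (1 + t^2)/(1 - t^2) if it
    keeps the direction of the previous step and 2t/(1 - t^2) if it
    changes it (label_seriesE), and the up-down runs are one more than the
    changes of direction (udrE). This yields exactly the rational function
    of t in the statement (run_series).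

    On the right-hand side, send a compatible pair (s, f) and a point i to
    its itinerary f(i), f(s i), f(s^2 i), and so on, a periodic word. Each
    odd letter reverses the order of the points that read it, so points
    are sorted by their itineraries in an alternating lexicographic order
    (itin_sorted), and the multiplicities of the itineraries determine (s,
    f) (compat_unique). Any shift-invariant multiplicities with sum n
    occur (compat_exists). Thus compatible pairs are multisets of
    primitive necklaces of total length n (sum_compat). Among the c points
    that share an itinerary of primitive period p, the p-th power of s is
    the identity if the period contains an even number of odd letters,
    giving c cycles of length p; otherwise it reverses them, giving c./2
    cycles of length 2p and one of length p when c is odd. Hence positive
    necklaces of length p contribute a factor 1/(1 - z_p x^p) each, and
    negative ones (1 + z_p x^p)/(1 - z_{2p} x^{2p})
    (coef_necklace_product).

    It remains to count necklaces. There are m^i words of period dividing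
    i, and their count with signs is 1 or 0 as m is odd or even. The
    difference of the two counts determines the negative necklaces by
    Moebius inversion over odd divisors, and their number of length i is
    g_exp i k for m = 2k and h_exp i k for m = 2k + 1 (g_expE, h_expE).
    The signed count alone shows that negative necklaces of length i are
    as many as the positive ones of length i and the negative ones of
    length i/2 together, up to one for i = 1 and m odd (nb_positiveE). So
    numerators and denominators get the same exponent, apart from the
    factor 1/(1 - z_1 x) for odd m (necklace_product). *)

(** * Up-down runs and direction changes *)

(** The value true at 0 makes an initial descent a change of direction,
    which accounts for the up-down run that consists of the first letter
    alone. *)
Definition direction (b : nat -> bool) (i : nat) : bool :=
  if i is i'.+1 then b i' else true.

Definition changes (b : nat -> bool) (n : nat) : nat :=
  \sum_(i < n) (b i != direction b i).

Definition constant_on (b : nat -> bool) (i j : nat) : bool :=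
  [forall k : 'I_j, forall l : 'I_j, (i <= k) && (i <= l) ==> (b k == b l)].

Section Runs.
Variable w : seq nat.
Hypothesis uniq_w : uniq w.

Let b i := nth 0 w i < nth 0 w i.+1.

Lemma constant_onP i j :
  reflect (forall k l, i <= k < j -> i <= l < j -> b k = b l) (constant_on b i j).
Proof.
apply: (iffP forallP) => [H k l /andP[ik kj] /andP[il lj] | H k].
  by have /forallP/(_ (Ordinal lj))/implyP/(_ _)/eqP := H (Ordinal kj); apply; rewrite /= ik.
by apply/forallP=> l; apply/implyP=> /andP[ik il]; apply/eqP/H; rewrite ?ik ?il ltn_ord.
Qed.

Lemma sorted_subword (r : rel nat) i j : j < size w ->
  reflect (forall k, i <= k < j -> r (nth 0 w k) (nth 0 w k.+1))
          (sorted r (subword w (i, j))).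
Proof.
move=> jw; rewrite /subword /=.
have sz : size (drop i (take j.+1 w)) = j.+1 - i.
  by rewrite size_drop size_take; case: ifP; lia.
have nthE k : i + k <= j -> nth 0 (drop i (take j.+1 w)) k = nth 0 w (i + k).
  by move=> kj; rewrite nth_drop nth_take.
apply: (iffP (sortedP 0)) => [H k /andP[ik kj] | H k]; rewrite sz in H *.
  have := H (k - i); rewrite !nthE; try lia.
  by rewrite addnS subnKC //; apply; lia.
by move=> kj; rewrite !nthE; try lia; rewrite addnS; apply: H; lia.
Qed.

(** Distinct letters turn a failure to ascend into a descent, so monotone
    means that all steps go in the same direction. *)
Lemma monotone_subword i j : j < size w ->
  monotone (subword w (i, j)) = constant_on b i j.
Proof.
move=> jw; apply/orP/constant_onP.
  case=> /(sorted_subword _ _ jw) H k l Hk Hl; rewrite /b; have := H k Hk; have := H l Hl.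
    by move=> /= -> ->.
  by move=> /= lt_l lt_k; apply/idP/idP; lia.
move=> H; case bi: (b i).
  left; apply/(sorted_subword _ _ jw)=> k /andP[ik kj].
  by rewrite /=; change (b k = true); rewrite -bi; apply: H; lia.
right; apply/(sorted_subword _ _ jw)=> k /andP[ik kj] /=.
have: b k = false by rewrite -bi; apply: H; lia.
rewrite /b ltnNge => /negbFE; rewrite leq_eqVlt => /predU1P[|//].
move/eqP; rewrite nth_uniq //; first by rewrite eqn_leq ltnn.
  exact: leq_ltn_trans jw.
exact: ltn_trans jw.
Qed.

Lemma constant_on1 i j : j <= i.+1 -> constant_on b i j.
Proof. by move=> ij; apply/constant_onP=> k l Hk Hl; congr b; lia. Qed.

Lemma mem_intervals n p : (p \in intervals n) = (p.1 <= p.2) && (p.2 < n).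
Proof.
rewrite mem_filter; case le12: (p.1 <= p.2) => //=.
apply/allpairsP/idP => [[q []] | lt2].
  by rewrite !mem_iota add0n => _ + -> /=.
by exists p; rewrite !mem_iota !add0n lt2 (leq_ltn_trans le12 lt2); case: (p).
Qed.

Lemma birunP i j : i <= j < size w ->
  reflect (constant_on b i j /\ forall i' j', i' <= i -> j <= j' < size w ->
             constant_on b i' j' -> i' = i /\ j' = j)
          (is_birun w (i, j)).
Proof.
move=> /andP[ij jw]; rewrite /is_birun monotone_subword //.
apply: (iffP andP) => [[-> /allP H] | [-> H]]; split=> //.
  move=> i' j' ii /andP[jj jw'] c.
  have := H (i', j'); rewrite mem_intervals /= jw' andbT ii jj monotone_subword // c.
  by move=> /(_ (leq_trans (leq_trans ii ij) jj)) /eqP[-> ->].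
apply/allP=> -[i' j']; rewrite mem_intervals /= => /andP[ij' jw'].
apply/implyP=> /and3P[ii jj]; rewrite monotone_subword // => c.
by have [|-> ->] := H i' j' ii _ c; rewrite ?jj ?jw'.
Qed.

(** Biruns are counted by their first position. Maximality fixes the last
    position once the first is known, and it forces the direction to
    change at the first position, as the run could otherwise be extended
    to the left. *)
Lemma sum_birun_from n i : size w = n.+1 -> i <= n ->
  \sum_(j < n.+1) ((i <= j) && is_birun w (i, j : nat)) =
  ((i < n) && ((i == 0) || (b i != b i.-1)))%N + ((n == 0) && (i == 0)).
Proof.
move=> sw; rewrite leq_eqVlt => /predU1P[->|lt_in].
  rewrite ltnn /=; have [n0|n_gt0] := posnP n; first (subst n).
    rewrite big_ord1 /=; apply/eqP; rewrite eqb1.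
    apply/birunP; rewrite ?sw //; split=> [|i' j']; first exact: constant_on1.
    by rewrite !leqn0 !ltnS leqn0 /= => /eqP-> /eqP->.
  rewrite big1 // => j _; apply/eqP; rewrite eqb0; apply/negP.
  case/andP=> nj /birunP; rewrite sw => /(_ _)[|_ /(_ n.-1 n)]; first by rewrite nj /=.
  have jn : j = n :> nat by have := ltn_ord j; lia.
  rewrite jn leqnn ltnSn => /(_ (leq_pred n) isT)[|nn _].
    by apply: constant_on1; rewrite prednK.
  by move: n_gt0 nn; clear; case: n => // n _ /= /n_Sn.
rewrite lt_in /= (_ : (n == 0) = false) ?addn0; last by lia.
have [st | nst] := boolP ((i == 0) || (b i != b i.-1)); last first.
  rewrite big1 // => j _; apply/eqP; rewrite eqb0; apply/negP=> /andP[ij].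
  move: nst; rewrite negb_or negbK => /andP[i0 /eqP bi].
  case/birunP; first by rewrite ij sw ltn_ord.
  have [->|jni] := eqVneq (j : nat) i.
    move=> _ /(_ i i.+1); rewrite sw => /(_ _ _ _) []; try lia.
    by apply: constant_on1.
  move/constant_onP=> cij /(_ i.-1 j); rewrite sw ltn_ord => /(_ _ _ _) []; try lia.
  have E k : i.-1 <= k < j -> b k = b i.
    move=> Hk; have [->|ki] := eqVneq k i.-1; first by rewrite bi.
    by apply: cij; have := ltn_ord j; lia.
  by apply/constant_onP=> k l Hk Hl; rewrite !E.
(* The run that begins at i ends at the largest j up to which the
   direction is constant. *)
pose P j := (j < n.+1) && constant_on b i j.
have exP : exists j, P j by exists i.+1; rewrite /P constant_on1 ?andbT.
have leP j : P j -> j <= n by case/andP; rewrite ltnS.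
case: (ex_maxnP exP leP) => j /andP[jn cij] jmax.
have ij : i < j by apply: jmax; rewrite /P constant_on1 ?andbT.
rewrite (bigD1 (Ordinal jn)) //= big1 ?addn0; last first.
  move=> k kj; apply/eqP; rewrite eqb0; apply/negP=> /andP[ik].
  case/birunP; first by rewrite ik sw ltn_ord.
  move=> cik; have kj' : k <= j by apply: jmax; rewrite /P ltn_ord.
  case/(_ i j) => //; first by rewrite kj' sw.
  by move=> _ jk; case/eqP: kj; apply: val_inj; rewrite /= jk.
apply/eqP; rewrite eqb1 ltnW //=; apply/birunP; first by rewrite sw ltnW.
split=> // i' j'; rewrite sw => ii /andP[jj jn'] /constant_onP c.
have ii' : i' = i.
  apply/eqP; rewrite eqn_leq ii leqNgt; apply/negP=> lt_i'i.
  by case/orP: st; [lia | case/eqP; apply: c; lia].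
split=> //; apply/eqP; rewrite eqn_leq jj andbT; apply: jmax; rewrite /P jn' /=.
by rewrite -ii'; apply/constant_onP.
Qed.

Lemma count_intervals n (P : pred (nat * nat)) :
  count P (intervals n) =
  \sum_(i < n) \sum_(j < n) ((i <= j) && P (i : nat, j : nat)).
Proof.
rewrite count_filter -sum1_count big_mkcond big_allpairs /=.
have iotaE : iota 0 n = index_iota 0 n by rewrite /index_iota subn0.
rewrite iotaE big_mkord; apply: eq_bigr => i _; rewrite big_mkord.
by apply: eq_bigr => j _; rewrite andbC; case: (_ && _).
Qed.

Lemma udr_word_changes n : size w = n.+1 -> udr_word w = (changes b n).+1.
Proof.
move=> sw; rewrite /udr_word sw count_intervals.
have E (i j : 'I_n.+1) : ((i <= j) && is_updown_run w (i : nat, j : nat) : nat) =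
    ((i <= j) && is_birun w (i : nat, j : nat)) +
    [&& 0 < n, i == ord0, j == ord0 & ~~ b 0].
  rewrite /is_updown_run sw /= ltnS.
  have [n_gt0|] /= := boolP (0 < n); last by rewrite orbF addn0.
  have -> : ((i : nat, j : nat) == (0, 0)) = (i == ord0) && (j == ord0).
    by rewrite xpair_eqE.
  have [-> /=|_] := eqVneq i ord0; last by rewrite orbF addn0.
  have [-> /=|_] := eqVneq j ord0; last by rewrite orbF addn0.
  have -> : (nth 0 w 1 < nth 0 w 0) = ~~ b 0.
    by rewrite /b -leqNgt ltn_neqAle nth_uniq ?sw.
  case: (boolP (is_birun _ _)) => [/birunP|]; last by [].
  rewrite sw => /(_ isT)[_ /(_ 0 1)]; case=> //.
  exact: constant_on1.
under eq_bigr => i _ do under eq_bigr => j _ do rewrite E.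
under eq_bigr => i _ do rewrite big_split /= sum_birun_from // -1?ltnS //.
rewrite big_split /=; have [n0|n_gt0] := posnP n.
  by subst n; rewrite /changes !big_ord_recl !big_ord0.
have -> : \sum_(i < n.+1) \sum_(j < n.+1) [&& true, i == ord0, j == ord0 & ~~ b 0]
    = ~~ b 0.
  rewrite (bigD1 ord0) //= (bigD1 ord0) //= !big1 ?addn0 //.
    by move=> i /negbTE i0; rewrite big1 // => j _; rewrite i0.
  by move=> j /negbTE ->.
rewrite (eq_bigr (fun i : 'I_n.+1 => (i < n) && ((i == 0 :> nat) || (b i != b i.-1)) : nat)).
  rewrite big_ord_recr /= ltnn addn0 /changes.
  case: n n_gt0 {sw E} => // n _; rewrite !big_ord_recl /= eqb_id.
  rewrite (eq_bigr (fun i : 'I_n => b (bump 0 i) != b (0 + i) : nat)).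
    by rewrite add1n addSn addnC.
  by move=> i _; rewrite /bump leq0n add1n ltnS ltn_ord.
by move=> i _; rewrite ltnS addn0.
Qed.
End Runs.

(** * Monotone labellings of a permutation *)

(** Labels start at 0; even labels are those of the increasing segments. *)
Definition step (c : bool) (x y : nat) : bool :=
  (x < y) || (x == y) && (c (+) odd x).

Definition compat n m (s : 'S_n) (f : {ffun 'I_n -> 'I_m}) : bool :=
  [forall i : 'I_n, forall j : 'I_n, (i < j) ==> step (s i < s j) (f i) (f j)].

Definition ascent n (s : 'S_n.+1) (i : nat) : bool :=
  s (inord i) < s (inord i.+1).

(** The last label exceeds the previous one, or repeats it if its parity
    allows the last step. The lemma label_seriesS turns this into a
    recursion on power series in the label. *)
Fixpoint last_label (b : nat -> bool) (n j : nat) : nat :=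
  if n is n'.+1 then
    \sum_(i < j) last_label b n' i + (b n' (+) odd j) * last_label b n' j
  else 1.

Section Chains.
Variables (b : nat -> bool) (m : nat).

Definition chain n (f : {ffun 'I_n.+1 -> 'I_m}) : bool :=
  [forall i : 'I_n, step (b i) (f (inord i)) (f (inord i.+1))].

Definition chain_ext n (p : {ffun 'I_n.+1 -> 'I_m} * 'I_m) :
    {ffun 'I_n.+2 -> 'I_m} :=
  [ffun i => if unlift ord_max i is Some k then p.1 k else p.2].

Definition chain_res n (f : {ffun 'I_n.+2 -> 'I_m}) :=
  ([ffun k => f (lift ord_max k)] : {ffun 'I_n.+1 -> 'I_m}, f ord_max).

Lemma chain_resK n : cancel (@chain_res n) (@chain_ext n).
Proof.
by move=> f; apply/ffunP=> i; rewrite ffunE; case: unliftP => [k|] -> //=; rewrite ffunE.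
Qed.

Lemma chain_extK n : cancel (@chain_ext n) (@chain_res n).
Proof.
move=> [f a]; congr (_, _); last by rewrite ffunE unlift_none.
by apply/ffunP=> k; rewrite !ffunE liftK.
Qed.

Lemma chain_extE n (p : {ffun 'I_n.+1 -> 'I_m} * 'I_m) k : k <= n ->
  chain_ext p (inord k) = p.1 (inord k).
Proof.
move=> kn; have -> : inord k = lift ord_max (inord k : 'I_n.+1).
  by apply: val_inj; rewrite /= /bump !inordK ?ltnS // 1?leqNgt 1?ltnS ?kn //; lia.
by rewrite ffunE liftK.
Qed.

Lemma chain_ext_last n (p : {ffun 'I_n.+1 -> 'I_m} * 'I_m) :
  chain_ext p (inord n.+1) = p.2.
Proof.
have -> : inord n.+1 = ord_max :> 'I_n.+2 by apply: val_inj; rewrite /= inordK.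
by rewrite ffunE unlift_none.
Qed.

Lemma chain_extP n (p : {ffun 'I_n.+1 -> 'I_m} * 'I_m) :
  chain (chain_ext p) = chain p.1 && step (b n) (p.1 (inord n)) p.2.
Proof.
apply/forallP/andP => [H | [/forallP H Hn] i].
  split; last by have := H ord_max; rewrite /= chain_extE // chain_ext_last.
  apply/forallP=> i; have := H (widen_ord (leqnSn _) i); rewrite /= !chain_extE //.
  exact: ltnW.
have [lt_in|ge_in] := ltnP i n.
  by have := H (Ordinal lt_in); rewrite /= !chain_extE // ltnW.
have -> : i = n :> nat by apply/eqP; rewrite eqn_leq ge_in -ltnS ltn_ord.
by rewrite chain_extE // chain_ext_last.
Qed.

(** The recursion of last_label comes from deleting the last point. *)
Lemma card_chain_last n (j : 'I_m) :
  \sum_(f : {ffun 'I_n.+1 -> 'I_m} | chain f && (f (inord n) == j)) 1 =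
  last_label b n j.
Proof.
elim: n j => [|n IH] j.
  rewrite (big_pred1 [ffun => j]) //= => f.
  apply/andP/eqP => [[_ /eqP <-]|->].
    by apply/ffunP => i; rewrite ffunE; congr (f _); apply: val_inj; rewrite /= inordK // ord1.
  by split; [apply/forallP; case | rewrite ffunE].
rewrite (reindex_onto (fun f => chain_ext (f, j)) (fun g => (chain_res g).1));
    last first.
  move=> g /andP[_ /eqP <-]; rewrite -[RHS]chain_resK; congr (chain_ext (_, g _)).
  by apply: val_inj; rewrite /= inordK.
under eq_bigl => f do
  rewrite chain_extP chain_ext_last (congr1 fst (chain_extK (f, j))) /= !eqxx !andbT.
rewrite (partition_big (fun f : {ffun 'I_n.+1 -> 'I_m} => f (inord n)) predT) //=.
transitivity (\sum_(i < m) step (b n) i j * last_label b n i).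
  apply: eq_bigr => i _; rewrite -IH; case st: (step _ i j); rewrite ?mul1n ?mul0n.
    by apply: eq_bigl => f; case: eqP => [->|]; rewrite ?st ?andbT ?andbF.
  by rewrite big_pred0 // => f; case: eqP => [->|]; rewrite ?st ?andbT ?andbF.
rewrite (bigID (fun i : 'I_m => i < j)) /= (big_ord_widen m) ?(ltnW (ltn_ord j)) //.
congr (_ + _); first by apply: eq_bigr => i ij; rewrite /step ij mul1n.
rewrite (bigD1 j) ?ltnn //= {1}/step ltnn eqxx big1 ?addn0 // => i /andP[ij nij].
by rewrite /step (negbTE ij) (inj_eq val_inj) (negbTE nij).
Qed.

Lemma card_chain n :
  #|[set f : {ffun 'I_n.+1 -> 'I_m} | chain f]| = \sum_(j < m) last_label b n j.
Proof.
rewrite -sum1dep_card (partition_big (fun f : {ffun 'I_n.+1 -> 'I_m} => f (inord n)) predT) //=.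
by apply: eq_bigr => j _; rewrite card_chain_last.
Qed.
End Chains.

(** The relation imposed on neighbours is transitive: a label shared by
    distant points is shared by all points in between. *)
Lemma compat_chain n m (s : 'S_n.+1) (f : {ffun 'I_n.+1 -> 'I_m}) :
  compat s f = chain (ascent s) f.
Proof.
apply/forallP/forallP => [H i | H].
  have /forallP/(_ (inord i.+1))/implyP := H (inord i).
  by apply; rewrite !inordK ?ltnS ?ltn_ord // ltnW.
pose r (i j : 'I_n.+1) := step (s i < s j) (f i) (f j).
have tr : transitive r.
  move=> y x z; rewrite /r /step => /orP[xy|/andP[/eqP xy exy]] /orP[yz|/andP[/eqP yz eyz]].
  - by rewrite (ltn_trans xy yz).
  - by rewrite -yz xy.
  - by rewrite xy yz.
  rewrite xy yz eqxx orbC /=; move: exy eyz; rewrite xy yz.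
  by case: (odd _); rewrite ?addbT ?addbF -?leqNgt; lia.
have srt : sorted r (enum 'I_n.+1).
  apply/(sortedP ord0) => i; rewrite size_enum_ord => lt_in.
  have := H (Ordinal (lt_in : i < n)).
  have E k : k < n.+1 -> nth ord0 (enum 'I_n.+1) k = inord k.
    by move=> kn; apply: val_inj; rewrite /= nth_enum_ord // inordK.
  by rewrite !E //; exact: ltnW.
move=> i; apply/forallP=> j; apply/implyP=> ij.
have := sorted_ltn_nth tr ord0 srt.
by move=> /(_ i j); rewrite !inE size_enum_ord !nth_ord_enum !ltn_ord; apply.
Qed.

Lemma card_compat n m (s : 'S_n.+1) :
  #|[set f : {ffun 'I_n.+1 -> 'I_m} | compat s f]| =
  \sum_(j < m) last_label (ascent s) n j.
Proof. by rewrite -card_chain; apply: eq_card => f; rewrite !inE compat_chain. Qed.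

Lemma udrE n (s : 'S_n.+1) : udr s = (changes (ascent s) n).+1.
Proof.
have sz : size (word_of_perm s) = n.+1 by rewrite /word_of_perm size_image card_ord.
rewrite /udr (udr_word_changes _ sz); last first.
  by rewrite map_inj_uniq ?enum_uniq // => i j [] /val_inj/perm_inj.
congr _.+1; apply: eq_bigr => i _.
have E k : k < n.+1 -> nth 0 (word_of_perm s) k = (s (inord k)).+1.
  move=> kn; rewrite (nth_map ord0) ?size_enum_ord //; congr (s _).+1.
  by apply: val_inj; rewrite /= nth_enum_ord // inordK.
by case: i => [[|i] lt_in] /=; rewrite !E // !ltnS 1?ltnW // ltnW.
Qed.

Lemma last_labelS b n j : last_label b n.+1 j =
  \sum_(i < j) last_label b n i + (b n (+) odd j) * last_label b n j.
Proof. by []. Qed.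

Arguments last_label : simpl never.

(** Label j may repeat at the last step and label j + 1 may not, so both
    are reached from the labels at most j. *)
Lemma last_label_flat b n j : direction b n (+) odd j ->
  last_label b n j.+1 = last_label b n j.
Proof.
case: n => [//|n] /= bj; rewrite !last_labelS big_ord_recr /= addbN bj.
by rewrite mul0n mul1n addn0.
Qed.

Lemma last_label_bottom b n : ~~ direction b n -> last_label b n 0 = 0.
Proof. by case: n => [//|n] /= /negbTE bn; rewrite last_labelS bn big_ord0. Qed.

Lemma last_label_recl b n j : last_label b n.+1 j.+2 =
  last_label b n.+1 j + ~~ (b n (+) odd j) * last_label b n j + last_label b n j.+1
  + (b n (+) odd j) * last_label b n j.+2.
Proof.
rewrite !last_labelS !big_ord_recr /= negbK -!addnA; congr (_ + _).
by case: (_ (+) _); rewrite /= ?mul1n ?mul0n ?addn0.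
Qed.

(** Labels j and j + 2 have the same parity, so the difference of their
    counts only involves the labels from j to j + 2 before the last step;
    last_label_flat, for the previous direction, merges two of these. *)
Lemma last_label_same b n j : b n = direction b n ->
  last_label b n.+1 j.+2 = last_label b n.+1 j + last_label b n j.+2 + last_label b n j.
Proof.
move=> bn; rewrite last_label_recl.
have := @last_label_flat b n j; have := @last_label_flat b n j.+1.
rewrite oddS -bn addbN; case: (_ (+) _) => /= H1 H2.
  by rewrite H2 //; lia.
by rewrite H1 //; lia.
Qed.

Lemma last_label_change b n j : b n != direction b n ->
  last_label b n.+1 j.+2 = last_label b n.+1 j + 2 * last_label b n j.+1.
Proof.
move=> bn; rewrite last_label_recl.
have := @last_label_flat b n j; have := @last_label_flat b n j.+1.
have -> : direction b n = ~~ b n by case: (b n) bn => /=; case: direction.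
rewrite oddS addbN addNb negbK; case: (_ (+) _) => /= H1 H2.
  by rewrite H1 //; lia.
by rewrite -H2 //; lia.
Qed.

(** * Periodic words over an alphabet with increasing and decreasing letters *)

Lemma porbit_dvdn (T : finType) (s : {perm T}) (x : T) k :
  ((s ^+ k)%g x == x) = (#|porbit s x| %| k).
Proof.
set p := #|_|; have p0 : 0 < p by rewrite lt0n card_porbit_neq0.
have sp : (s ^+ p)%g x = x by rewrite permX iter_porbit.
have spq q : (s ^+ (q * p))%g x = x.
  by elim: q => [|q IH]; rewrite ?perm1 // mulSn expgD permM sp.
rewrite {1}(divn_eq k p) expgD permM spq /dvdn.
have := uniq_traject_porbit s x; rewrite -/p.
case: (posnP (k %% p)) => [->|r0 U]; first by rewrite perm1 eqxx.
rewrite permX -(nth_traject s (ltn_pmod k p0)) -[X in _ == X](nth_traject s p0 x).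
by rewrite nth_uniq ?size_traject ?ltn_pmod // gtn_eqF.
Qed.

Section Words.
Variables (m l : nat).
Notation word := {ffun 'I_l.+1 -> 'I_m}.
Implicit Types w v : word.

Definition letter w (k : nat) : 'I_m := w (inord (k %% l.+1)).

Definition shift w : word := [ffun j => w (ordS j)].

Lemma letter_mod w k : letter w (k %% l.+1) = letter w k.
Proof. by rewrite /letter modn_mod. Qed.

Lemma letter_ord w (j : 'I_l.+1) : letter w j = w j.
Proof. by rewrite /letter modn_small // inord_val. Qed.

Lemma letter_inj w v : letter w =1 letter v -> w = v.
Proof. by move=> e; apply/ffunP=> j; rewrite -!letter_ord. Qed.

Lemma letter_shift w k : letter (shift w) k = letter w k.+1.
Proof.
rewrite /letter ffunE; congr (w _); apply: val_inj.
by rewrite /= !inordK ?ltn_pmod // -addn1 modnDml addn1.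
Qed.

Lemma shift_inj : injective shift.
Proof.
move=> w v e; apply/ffunP => j; have [g _ gK] := @ordS_bij l.+1.
by move/ffunP/(_ (g j)): e; rewrite !ffunE gK.
Qed.

Definition rotation : {perm word} := perm shift_inj.

Lemma letter_rotation w i k : letter ((rotation ^+ i)%g w) k = letter w (i + k).
Proof.
elim: i k => [|i IH] k; first by rewrite perm1.
by rewrite expgSr permM permE letter_shift IH addnS.
Qed.

(** The number whose base-m digits are the letters of w, a digit being
    complemented when an odd number of decreasing letters precede it.
    Comparing these numbers compares words in the alternating
    lexicographic order. *)
Fixpoint key d w : nat :=
  if d is d'.+1 then
    letter w 0 * m ^ d' +
    (if odd (letter w 0) then m ^ d' - (key d' (shift w)).+1 else key d' (shift w))
  else 0.

Lemma key_lt d w : key d w < m ^ d.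
Proof.
elim: d w => [|d IH] w //=; have := IH (shift w); rewrite expnS.
set a := letter w 0; set k := key _ _; set M := m ^ d => kM.
have : (a.+1 * M <= m * M) by rewrite leq_mul2r ltn_ord orbT.
by rewrite mulSn; case: (odd a) => ?; lia.
Qed.

Lemma key_ltE d w v : (key d.+1 w < key d.+1 v) =
  (letter w 0 < letter v 0) || (letter w 0 == letter v 0) &&
    (if odd (letter w 0) then key d (shift v) < key d (shift w)
     else key d (shift w) < key d (shift v)).
Proof.
rewrite /= -(inj_eq val_inj) /=.
have := key_lt d (shift w); have := key_lt d (shift v).
move: (key d _) (key d _) (letter w 0 : nat) (letter v 0 : nat) (m ^ d).
move=> k k' a b M kM k'M; case: (ltngtP a b) => [ab|ba|->] /=.
- have : a.+1 * M <= b * M by rewrite leq_mul2r ab orbT.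
  by rewrite mulSn; do 2 case: ifP => _; lia.
- have : b.+1 * M <= a * M by rewrite leq_mul2r ba orbT.
  by rewrite mulSn; do 2 case: ifP => _; lia.
by rewrite ltn_add2l; case: ifP => _; lia.
Qed.

Lemma key_refine d w v : key d w < key d v -> key d.+1 w < key d.+1 v.
Proof.
elim: d w v => [//|d IH] w v; rewrite (key_ltE d) (key_ltE d.+1).
by case/orP=> [->//|/andP[-> ]]; case: ifP => _ /IH->; rewrite orbT.
Qed.

Lemma key_eq_letters d w v : key d w = key d v ->
  forall k, k < d -> letter w k = letter v k.
Proof.
elim: d w v => [//|d IH] w v e [|k] kd.
  have := key_ltE d w v; have := key_ltE d v w; rewrite e ltnn.
  by case: ltngtP => // /val_inj.
rewrite -!letter_shift; apply: IH => //.
have := key_ltE d w v; have := key_ltE d v w; rewrite e ltnn.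
case: ltngtP => // /val_inj ->; rewrite eqxx /=.
by case: ifP => _; case: ltngtP.
Qed.

Definition word_key w := key l.+1 w.

Lemma word_key_inj : injective word_key.
Proof.
move=> w v /key_eq_letters e; apply: letter_inj => k.
by rewrite -letter_mod -[RHS]letter_mod e ?ltn_pmod.
Qed.

Lemma word_key_head w v : word_key w <= word_key v -> letter w 0 <= letter v 0.
Proof. by rewrite leqNgt key_ltE negb_or -leqNgt => /andP[]. Qed.

(** Words that agree in their first letter are compared by the rest, in
    the opposite sense if that letter is decreasing. The first letter,
    which the shift moves to the end, cannot matter, as the words already
    differ before. *)
Lemma word_key_shift w v : w != v -> letter w 0 = letter v 0 ->
  (word_key (shift w) < word_key (shift v)) =
  (word_key w < word_key v) (+) odd (letter w 0).
Proof.
move=> nwv e; rewrite [in RHS]key_ltE e ltnn eqxx /=.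
have nk : key l (shift w) != key l (shift v).
  apply: contra nwv => /eqP ek; apply/eqP/word_key_inj.
  by rewrite /word_key /= e ek.
rewrite /word_key; case: (ltngtP (key l (shift w)) (key l (shift v))) nk => // lt _.
  by rewrite (key_refine lt); case: ifP.
have := key_refine lt; case: ltngtP => // _ _.
by case: ifP.
Qed.
End Words.

(** * Counting primitive necklaces *)

Section Necklaces.
Variables (m l : nat).
Notation word := {ffun 'I_l.+1 -> 'I_m}.
Notation sigma := (rotation m l).
Implicit Types w v : word.

Definition period w : nat := #|porbit sigma w|.

(** The sign of the return map: reading one primitive period of w reverses
    the order of the points with itinerary w exactly when w is negative. *)
Definition negative w : bool := odd (\sum_(j < period w) odd (letter w j)).

Lemma period_gt0 w : 0 < period w.
Proof. by rewrite lt0n card_porbit_neq0. Qed.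

Lemma letter_period w i k : period w %| i -> letter w (i + k) = letter w k.
Proof. by rewrite -porbit_dvdn => /eqP e; rewrite -letter_rotation e. Qed.

Lemma period_rotation w i : period ((sigma ^+ i)%g w) = period w.
Proof. by rewrite /period porbit_perm. Qed.

Lemma negative_shift w : negative (shift w) = negative w.
Proof.
have -> : shift w = (sigma ^+ 1)%g w by rewrite expg1 permE.
rewrite /negative period_rotation; congr odd.
have [p Ep] : exists p, period w = p.+1 by exists (period w).-1; rewrite prednK ?period_gt0.
rewrite Ep big_ord_recr [RHS]big_ord_recl addnC; congr (_ + _).
  by apply: eq_bigr => j _; rewrite letter_rotation.
by rewrite letter_rotation /= add1n -Ep -[X in letter _ X]addn0 letter_period.
Qed.

Lemma negative_rotation w i : negative ((sigma ^+ i)%g w) = negative w.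
Proof.
elim: i => [|i IH]; first by rewrite perm1.
by rewrite expgSr permM permE negative_shift.
Qed.

Lemma negative_porbit w v : v \in porbit sigma w -> negative v = negative w.
Proof. by case/porbitP => i ->; rewrite negative_rotation. Qed.

Local Open Scope ring_scope.

Definition sign (a : 'I_m) : int := (-1) ^+ odd a.

Lemma prod_sign_period w : \prod_(j < period w) sign (letter w j) = (-1) ^+ negative w.
Proof. by rewrite prodrXr signr_odd. Qed.

Lemma prod_letters_period (phi : 'I_m -> int) w q :
  \prod_(j < q * period w) phi (letter w j) =
  (\prod_(j < period w) phi (letter w j)) ^+ q.
Proof.
elim: q => [|q IH]; first by rewrite big_ord0.
rewrite mulSn big_split_ord /= exprS; congr (_ * _).
by rewrite -IH; apply: eq_bigr => j _; rewrite letter_period.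
Qed.

(** A word whose period divides i consists of repetitions of its first i
    letters, which are arbitrary; the sum of products over these letters
    factors. *)
Lemma sum_periodic_words (phi : 'I_m -> int) i : (0 < i)%N -> (i %| l.+1)%N ->
  \sum_(w : word | (period w %| i)%N) \prod_(j < i) phi (letter w j) =
  (\sum_a phi a) ^+ i.
Proof.
case: i => // i _ il.
rewrite -[in RHS](card_ord i.+1) -prodr_const bigA_distr_bigA /=.
rewrite (reindex_onto
  (fun f : {ffun 'I_i.+1 -> 'I_m} => [ffun j : 'I_l.+1 => f (inord (j %% i.+1))])
  (fun w => [ffun j : 'I_i.+1 => letter w j])) /=; last first.
  move=> w pw; apply/ffunP=> j; rewrite !ffunE inordK ?ltn_pmod //.
  rewrite -[in RHS]letter_ord {2}(divn_eq j i.+1) letter_period //.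
  exact: dvdn_mull.
have letE (f : {ffun 'I_i.+1 -> 'I_m}) k :
    letter [ffun j : 'I_l.+1 => f (inord (j %% i.+1))] k = f (inord (k %% i.+1)).
  by rewrite /letter ffunE inordK ?ltn_pmod // modn_dvdm.
apply: eq_big => f; last first.
  by move=> _; apply: eq_bigr => j _; rewrite letE modn_small // inord_val.
rewrite -porbit_dvdn; apply/andP; split.
  by apply/eqP/letter_inj => k; rewrite letter_rotation !letE modnDl.
by apply/eqP/ffunP=> j; rewrite ffunE letE modn_small // inord_val.
Qed.

Lemma sum_sign : \sum_(a < m) sign a = (odd m)%:R.
Proof.
rewrite /sign; elim: m => [|m' IH]; first by rewrite big_ord0.
by rewrite big_ord_recr /= IH; case: (odd m').
Qed.

Definition nb_words p c : nat := #|[set w : word | (period w == p) && (negative w == c)]|.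

Lemma sum_words_by_period (F : nat -> bool -> int) i : (0 < i)%N ->
  \sum_(w : word | (period w %| i)%N) F (period w) (negative w) =
  \sum_(p < i.+1 | (p %| i)%N)
    ((nb_words p false)%:R * F p false + (nb_words p true)%:R * F p true).
Proof.
move=> i0; rewrite (partition_big (fun w => inord (period w) : 'I_i.+1)
  (fun p => (p %| i)%N)) /=; last first.
  by move=> w pw; rewrite inordK // ltnS dvdn_leq.
apply: eq_bigr => p pi; rewrite (bigID negative) /= addrC.
have E c : \sum_(w : word | ((period w %| i)%N && (inord (period w) == p)) && (negative w == c))
    F (period w) (negative w) = (nb_words p c)%:R * F p c.
  rewrite /nb_words -sum1dep_card natr_sum mulr_suml.
  apply: eq_big => [w|w /andP[/andP[pw /eqP<-] /eqP->]]; last first.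
    by rewrite inordK ?mul1r // ltnS dvdn_leq.
  have [pw|npw] := eqVneq (period w) p; first by rewrite pw pi inord_val eqxx.
  apply/negbTE/negP => /andP[/andP[pw /eqP e] _]; case/eqP: npw.
  by rewrite -e inordK // ltnS dvdn_leq.
rewrite -!E; congr (_ + _); apply: eq_bigl => w; first by rewrite eqbF_neg.
by rewrite eqb_id.
Qed.

Lemma nb_words_total i : (0 < i)%N -> (i %| l.+1)%N ->
  \sum_(p < i.+1 | (p %| i)%N) ((nb_words p false)%:R + (nb_words p true)%:R)
  = m%:R ^+ i :> int.
Proof.
move=> i0 il.
have cm : \sum_(a : 'I_m) 1 = m%:R :> int by rewrite sumr_const card_ord.
have := sum_periodic_words (fun=> 1) i0 il; rewrite cm => <-.
under [RHS]eq_bigr => w _ do rewrite big1_eq.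
rewrite (sum_words_by_period (fun _ _ => 1) i0).
by apply: eq_bigr => p _; rewrite !mulr1.
Qed.

(** The sign of i letters of a word of period p is the sign of one period
    to the power i/p, and the sum of the signs of all letters is 0 or 1. *)
Lemma nb_words_signed i : (0 < i)%N -> (i %| l.+1)%N ->
  \sum_(p < i.+1 | (p %| i)%N)
    ((nb_words p false)%:R + (nb_words p true)%:R * (-1) ^+ (i %/ p)%N)
  = (odd m)%:R :> int.
Proof.
move=> i0 il.
have := sum_periodic_words sign i0 il.
have -> : (\sum_a sign a) ^+ i = (odd m)%:R.
  by rewrite sum_sign; case: (odd m); rewrite ?expr1n // expr0n gtn_eqF.
move=> <-.
transitivity (\sum_(w : word | (period w %| i)%N) ((-1) ^+ negative w) ^+ (i %/ period w)%N : int).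
  rewrite (sum_words_by_period (fun p c => ((-1) ^+ c) ^+ (i %/ p)%N) i0).
  by apply: eq_bigr => p _; rewrite expr0 expr1n mulr1 expr1.
apply: eq_bigr => w pw; rewrite -prod_sign_period -prod_letters_period.
by rewrite divnK.
Qed.

(** ** From words to necklaces *)

Definition negative_necklace (O : {set word}) : bool :=
  [exists w, (w \in O) && negative w].

Lemma negative_necklaceE w : negative_necklace (porbit sigma w) = negative w.
Proof.
apply/existsP/idP => [[v /andP[/negative_porbit->]]//|nw].
by exists w; rewrite porbit_id.
Qed.

Definition nb_necklaces p c : nat :=
  #|[set O in porbits sigma | (#|O| == p) && (negative_necklace O == c)]|.

Lemma nb_necklacesE p c : nb_words p c = (nb_necklaces p c * p)%N.
Proof.
rewrite /nb_words -sum1_card.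
rewrite (partition_big_imset (porbit sigma)) /=.
rewrite (eq_bigr (fun=> p)) => [|O /imsetP[w]]; last first.
  rewrite inE => /andP[/eqP pw /eqP nw] ->; rewrite sum1dep_card -pw.
  apply: eq_card => v; rewrite !inE eq_porbit_mem andbC.
  case: (boolP (v \in porbit sigma w)) => //= vw.
  rewrite (negative_porbit vw) nw eqxx andbT /period.
  by move: vw; rewrite -eq_porbit_mem => /eqP->; rewrite eqxx.
rewrite sum_nat_const; congr (_ * _)%N; apply: eq_card => O; rewrite [RHS]inE.
apply/imsetP/andP => [[w]|[/imsetP[w _ ->]]].
  rewrite inE => wp ->; split; last by rewrite negative_necklaceE.
  by apply: imset_f.
by rewrite negative_necklaceE => wp; exists w; rewrite ?inE.
Qed.
End Necklaces.

(** * Labelled permutations and multisets of necklaces *)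

Lemma perm_order_eq n (s s' : 'S_n) :
  (forall i j, (s i < s j) = (s' i < s' j)) -> s = s'.
Proof.
have rankE (u : 'S_n) i : #|[set j | u j < u i]| = u i.
  transitivity #|u @^-1: [set k : 'I_n | k < u i]|.
    by apply: eq_card => j; rewrite !inE.
  rewrite card_preimset; last exact: perm_inj.
  rewrite -sum1dep_card -(big_ord_widen n (fun=> 1)) ?sum1_card ?card_ord //.
  exact: ltnW.
move=> e; apply/permP => i; apply: val_inj; rewrite /= -[LHS]rankE -[RHS]rankE.
by apply: eq_card => j; rewrite !inE e.
Qed.

Lemma rank_perm_exists n (kappa : 'I_n -> nat) : injective kappa ->
  exists s : 'S_n, forall i j, (s i < s j) = (kappa i < kappa j).
Proof.
move=> kinj; pose r i := #|[set j | kappa j < kappa i]|.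
have r_homo i j : kappa i < kappa j -> r i < r j.
  move=> lt_ij; apply: proper_card; apply/properP; split.
    by apply/subsetP=> k; rewrite !inE => /ltn_trans; apply.
  by exists i; rewrite !inE ?ltnn.
have r_lt i : r i < n.
  rewrite -[X in _ < X]card_ord -cardsT; apply: proper_card; apply/properP.
  by split; [apply/subsetP=> k; rewrite inE | exists i; rewrite inE ?ltnn].
have r_mono i j : (r i < r j) = (kappa i < kappa j).
  case: (ltngtP (kappa i) (kappa j)) => [/r_homo//|/r_homo|/kinj->]; last by rewrite ltnn.
  by case: ltngtP.
have r_inj : injective (fun i => Ordinal (r_lt i)).
  move=> i j [] e; apply: kinj.
  by case: (ltngtP (kappa i) (kappa j)) => // /r_homo; rewrite e ltnn.
by exists (perm r_inj) => i j; rewrite !permE /= r_mono.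
Qed.

Section SortedFamilies.
Variables (T : finType) (key : T -> nat).
Hypothesis key_inj : injective key.

Definition fiber_card n (w : 'I_n -> T) v := #|[set i | w i == v]|.

Definition key_sorted n (w : 'I_n -> T) : Prop :=
  forall i j : 'I_n, i < j -> key (w i) <= key (w j).

Let leT : rel T := relpre key leq.

Lemma count_fiber n (w : 'I_n -> T) v :
  count_mem v [seq w i | i <- enum 'I_n] = fiber_card w v.
Proof.
rewrite count_map /fiber_card cardE -size_filter /enum_mem -filter_predI.
by congr (size _); apply: eq_filter => i; rewrite /= !inE andbT.
Qed.

Lemma key_sorted_unique n (w w' : 'I_n -> T) : key_sorted w -> key_sorted w' ->
  fiber_card w =1 fiber_card w' -> w =1 w'.
Proof.
have leT_trans : transitive leT by move=> x y z; apply: leq_trans.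
have leT_anti : antisymmetric leT.
  by move=> x y; rewrite /leT /= -eqn_leq => /eqP/key_inj.
have srt u : key_sorted u -> sorted leT [seq u i | i <- enum 'I_n].
  move=> us; have: sorted ltn (map val (enum 'I_n)).
    by rewrite val_enum_ord iota_ltn_sorted.
  by rewrite sorted_map; apply: homo_sorted => i j; apply: us.
move=> ws ws' e i.
have E : [seq w i | i <- enum 'I_n] = [seq w' i | i <- enum 'I_n].
  apply: (sorted_eq leT_trans leT_anti); rewrite ?srt //.
  by apply/allP => v _; rewrite /= !count_fiber e.
by move/eq_in_map: E; apply; rewrite mem_enum.
Qed.

Lemma key_sorted_exists n (c : T -> nat) : \sum_v c v = n ->
  exists w : 'I_n -> T, key_sorted w /\ fiber_card w =1 c.
Proof.
move=> sc; pose s := sort leT (flatten [seq nseq (c v) v | v <- enum T]).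
have sz : size s = n.
  rewrite size_sort size_flatten /shape -map_comp sumnE big_map big_enum /= -sc.
  by apply: eq_bigr => v _; rewrite /= size_nseq.
have cnt v : count_mem v s = c v.
  rewrite count_sort count_flatten -map_comp sumnE big_map big_enum /=.
  rewrite (bigD1 v) //= count_nseq /= eqxx mul1n big1 ?addn0 // => u /negbTE uv.
  by rewrite count_nseq /= uv mul0n.
have srt : sorted leT s by apply: sort_sorted => x y; apply: leq_total.
pose t := Tuple (introT eqP sz); exists (tnth t); split=> [i j ij|v].
  have [x0 _] : exists x0 : T, true by exists (tnth t i).
  rewrite (tnth_nth x0 t i) (tnth_nth x0 t j); apply: (@sorted_ltn_nth _ leT _ _ s) => //.
  - by move=> x y z; apply: leq_trans.
  - by rewrite inE sz.
  - by rewrite inE sz.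
by rewrite -cnt -count_fiber map_tnth_enum.
Qed.
End SortedFamilies.

Lemma compat_ltP n m (s : 'S_n) (f : {ffun 'I_n -> 'I_m}) :
  reflect (forall i j : 'I_n, i < j -> step (s i < s j) (f i) (f j)) (compat s f).
Proof.
apply: (iffP forallP) => [H i j ij|H i].
  by have /forallP/(_ j)/implyP/(_ ij) := H i.
by apply/forallP=> j; apply/implyP; apply: H.
Qed.

Section Itineraries.
Variables (n m l : nat).
Hypothesis dvd_fact : n`! %| l.+1.
Notation word := {ffun 'I_l.+1 -> 'I_m}.
Notation sigma := (rotation m l).
Implicit Types (s : 'S_n) (f : {ffun 'I_n -> 'I_m}) (v : word).

Definition itin s f (i : 'I_n) : word := [ffun j : 'I_l.+1 => f ((s ^+ j)%g i)].

Lemma letter_itin s f i k : letter (itin s f i) k = f ((s ^+ k)%g i).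
Proof.
rewrite /letter ffunE inordK ?ltn_pmod // expg_mod //; apply/permP => j.
apply/eqP; rewrite perm1 porbit_dvdn (dvdn_trans _ dvd_fact) // dvdn_fact //.
by rewrite lt0n card_porbit_neq0 -[n in _ <= n]card_ord max_card.
Qed.

Lemma itin_next s f i : itin s f (s i) = shift (itin s f i).
Proof.
apply: letter_inj => k; rewrite letter_shift !letter_itin.
by rewrite expgS permM.
Qed.

Lemma itin_iter s f i k : itin s f ((s ^+ k)%g i) = (sigma ^+ k)%g (itin s f i).
Proof.
by apply: letter_inj => j; rewrite letter_rotation !letter_itin expgD permM.
Qed.

Lemma itin_head s f i : letter (itin s f i) 0 = f i.
Proof. by rewrite letter_itin perm1. Qed.

Section Compatible.
Variables (s : 'S_n) (f : {ffun 'I_n -> 'I_m}).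
Hypothesis sf : compat s f.

Lemma compat_le (i j : 'I_n) : i <= j -> f i <= f j.
Proof.
rewrite leq_eqVlt => /predU1P[/val_inj->//|ij].
by have /compat_ltP/(_ _ _ ij)/orP[/ltnW|/andP[/eqP->]] := sf.
Qed.

Lemma compat_eq (i j : 'I_n) : i != j -> f i = f j ->
  (s i < s j) = (i < j) (+) odd (f i).
Proof.
move=> nij e; case: (ltngtP i j) => [ij|ji|/val_inj ij]; last by rewrite ij eqxx in nij.
  have /compat_ltP/(_ _ _ ij) := sf; rewrite /step e ltnn eqxx /=.
  by case: (_ < _); case: odd.
have /compat_ltP/(_ _ _ ji) := sf; rewrite /step e ltnn eqxx /=.
case: ltngtP => //; first by case: odd.
by move/val_inj/perm_inj => ij; rewrite ij eqxx in nij.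
Qed.

(** By compat_eq, points with the same label keep their order under s or
    exchange it, according to the parity of that label; here the labels
    agree at every step. *)
Lemma iter_order (i j : 'I_n) k : i != j -> itin s f i = itin s f j ->
  ((s ^+ k)%g i < (s ^+ k)%g j) =
  (i < j) (+) odd (\sum_(p < k) odd (letter (itin s f i) p)).
Proof.
move=> nij e; elim: k => [|k IH]; first by rewrite big_ord0 addbF !perm1.
rewrite big_ord_recr oddD addbA -IH expgSr !permM compat_eq.
- by rewrite letter_itin oddb.
- by rewrite (inj_eq perm_inj).
by rewrite -!letter_itin e.
Qed.

(** If two itineraries were in the wrong order, their first letters would
    agree, as labels increase with the position. The images under s would
    again be in the wrong order, up to exchanging them, since the first
    letter affects positions and itineraries alike. So all letters would
    agree. *)
Lemma itin_sorted : key_sorted (@word_key m l) (itin s f).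
Proof.
move=> i0 j0 ij0; rewrite leqNgt; apply/negP => lt0.
suff E k (i j : 'I_n) : i < j -> word_key (itin s f j) < word_key (itin s f i) ->
    f ((s ^+ k)%g i) = f ((s ^+ k)%g j).
  suff e : itin s f i0 = itin s f j0 by rewrite e ltnn in lt0.
  by apply: letter_inj => k; rewrite !letter_itin (E k i0 j0).
elim: k i j {i0 j0 ij0 lt0} => [|k IH] i j ij lt_ji.
  rewrite !perm1; apply: val_inj; apply/eqP; rewrite /= eqn_leq (compat_le (ltnW ij)) /=.
  by have := word_key_head (ltnW lt_ji); rewrite !itin_head.
have fij : f i = f j.
  apply: val_inj; apply/eqP; rewrite /= eqn_leq (compat_le (ltnW ij)) /=.
  by have := word_key_head (ltnW lt_ji); rewrite !itin_head.
have nij : i != j by case: eqP ij => // ->; rewrite ltnn.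
have nw : itin s f i != itin s f j by case: eqP lt_ji => // ->; rewrite ltnn.
have := compat_eq nij fij; have := word_key_shift nw.
rewrite !itin_head fij -!itin_next => /(_ erefl).
have -> : (word_key (itin s f i) < word_key (itin s f j)) = false.
  by rewrite ltnNge ltnW.
rewrite ij /= !expgS !permM.
have nij' : itin s f (s i) != itin s f (s j).
  by rewrite !itin_next (inj_eq (@shift_inj _ _)).
have nsij : s i != s j by rewrite (inj_eq perm_inj).
case: odd => /= [lt' nlt'|nlt' lt']; last first.
  apply: IH => //; case: (ltngtP (word_key (itin s f (s i)))) nlt' => // /word_key_inj e.
  by rewrite e eqxx in nij'.
apply/esym/IH => //; case: (ltngtP (s i)) nlt' => // /val_inj e.
by rewrite e eqxx in nsij.
Qed.

End Compatible.

(** The order of s i and s j is decided by their itineraries, which are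
    the shifted words, and if these agree by the order of i and j,
    reversed after a decreasing letter. The key packs both criteria into
    one number. *)
Definition order_key (w : 'I_n -> word) (i : 'I_n) : nat :=
  word_key (shift (w i)) * n + (if odd (letter (w i) 0) then n - i.+1 else i).

Lemma order_key_lt (w : 'I_n -> word) i j :
  word_key (shift (w i)) < word_key (shift (w j)) -> order_key w i < order_key w j.
Proof.
rewrite /order_key; move: (word_key _) (word_key _) => b a ab.
have : a.+1 * n <= b * n by rewrite leq_mul2r ab orbT.
have := ltn_ord i; rewrite mulSn; do 2 case: ifP => _; lia.
Qed.

Lemma order_key_eq (w : 'I_n -> word) i j : w i = w j -> i != j ->
  (order_key w i < order_key w j) = (i < j) (+) odd (letter (w i) 0).
Proof.
move=> e nij; rewrite /order_key e ltn_add2l.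
have := ltn_ord i; have := ltn_ord j.
have : i != j :> nat by [].
by case: odd; rewrite ?addbT ?addbF => *; apply/idP/idP; lia.
Qed.

Lemma order_key_inj (w : 'I_n -> word) : injective (order_key w).
Proof.
move=> i j e; case: (ltngtP (word_key (shift (w i))) (word_key (shift (w j)))).
- by move/order_key_lt; rewrite e ltnn.
- by move/order_key_lt; rewrite e ltnn.
move/word_key_inj/shift_inj => ew; apply/eqP; case: eqVneq => // nij.
have nji : j != i by rewrite eq_sym.
have := order_key_eq ew nij; have := order_key_eq (esym ew) nji.
rewrite e ltnn ew.
by case: (ltngtP i j) nij => // [| |/val_inj->]; rewrite ?eqxx //; case: odd.
Qed.

Lemma compat_order_key s f : compat s f ->
  forall i j, (s i < s j) = (order_key (itin s f) i < order_key (itin s f) j).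
Proof.
move=> sf i j; have [->|nij] := eqVneq i j; first by rewrite !ltnn.
have [e|ne] := eqVneq (itin s f i) (itin s f j).
  rewrite order_key_eq // itin_head (compat_eq sf nij) //.
  by rewrite -(itin_head s f i) e itin_head.
have half i' j' : itin s f i' != itin s f j' -> s i' < s j' ->
    order_key (itin s f) i' < order_key (itin s f) j'.
  move=> ne' lt; apply: order_key_lt; rewrite -!itin_next ltn_neqAle itin_sorted // andbT.
  by rewrite (inj_eq (@word_key_inj _ _)) !itin_next (inj_eq (@shift_inj _ _)).
apply/idP/idP; first exact: half.
case: (ltngtP (s i) (s j)) => // [ji|/val_inj/perm_inj ij]; last by rewrite ij ltnn.
have nji : itin s f j != itin s f i by rewrite eq_sym.
by have := half _ _ nji ji; case: ltngtP.
Qed.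

(** The multiplicities determine the sorted family of itineraries; its
    first letters are the labels, and order_key recovers the relative
    order of the values of s. *)
Lemma compat_unique s f s' f' : compat s f -> compat s' f' ->
  fiber_card (itin s f) =1 fiber_card (itin s' f') -> (s, f) = (s', f').
Proof.
move=> sf sf' e.
have ew := key_sorted_unique (@word_key_inj m l) (itin_sorted sf) (itin_sorted sf') e.
congr (_, _); last by apply/ffunP => i; rewrite -(itin_head s f) ew itin_head.
apply: perm_order_eq => i j; rewrite (compat_order_key sf) (compat_order_key sf').
by rewrite /order_key !ew.
Qed.

(** The multiplicities give a sorted family w of words, and order_key a
    permutation s. The families w and shift o w o s^-1 are both sorted and
    have the same multiplicities, by shift invariance. So they coincide,
    and w is the family of itineraries of s. *)
Lemma compat_exists (c : word -> nat) : \sum_v c v = n ->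
  (forall v, c (shift v) = c v) ->
  exists s f, compat s f /\ fiber_card (itin s f) =1 c.
Proof.
move=> sc c_shift.
have [w [ws wc]] := key_sorted_exists (@word_key m l) sc.
have [s sE] := rank_perm_exists (@order_key_inj w).
have ws_shift : w \o s =1 @shift m l \o w.
  suff E : w =1 (fun i => shift (w (s^-1 i)%g)) by move=> i /=; rewrite E permK.
  apply: (key_sorted_unique (@word_key_inj m l)) => //.
    move=> i j ij; rewrite leqNgt; apply/negP => /order_key_lt.
    by rewrite -sE !permKV ltnNge ltnW.
  move=> v; have [g _ gK] := injF_bij (@shift_inj m l); rewrite -(gK v).
  rewrite wc c_shift -wc /fiber_card -(card_imset _ (@perm_inj _ s)).
  apply: eq_card => i; rewrite !inE; apply/imsetP/eqP => [[j]|/shift_inj/eqP e].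
    by rewrite inE => /eqP <- ->; rewrite permK.
  by exists (s^-1 i)%g; rewrite ?inE ?permKV.
pose f : {ffun 'I_n -> 'I_m} := [ffun i => letter (w i) 0].
have itE : itin s f =1 w.
  move=> i; apply: letter_inj => k; rewrite letter_itin ffunE.
  suff -> : w ((s ^+ k)%g i) = (sigma ^+ k)%g (w i) by rewrite letter_rotation addn0.
  elim: k => [|k IH]; first by rewrite !perm1.
  by rewrite !expgSr !permM -IH permE -[RHS]ws_shift.
exists s, f; split; last by move=> v; rewrite -wc /fiber_card; apply: eq_card => i; rewrite !inE itE.
apply/compat_ltP => i j ij; rewrite /step !ffunE.
have := word_key_head (ws _ _ ij); rewrite leq_eqVlt => /orP[/eqP e|->//].
rewrite e eqxx orbC sE /=; have nij : i != j by case: eqP ij => // ->; rewrite ltnn.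
have [eqw|new] := eqVneq (w i) (w j).
  by rewrite (order_key_eq eqw nij) ij e; case: odd.
have ltw : word_key (w i) < word_key (w j).
  by rewrite ltn_neqAle ws // andbT (inj_eq (@word_key_inj _ _)).
have := word_key_shift new (val_inj e); rewrite ltw e /=.
case: odd => /= H; last by rewrite (order_key_lt H).
rewrite addbT -leqNgt ltnW //; apply: order_key_lt.
case: ltngtP H => // /word_key_inj/shift_inj E.
by rewrite E eqxx in new.
Qed.

End Itineraries.

(** * Cycle type of a labelled permutation *)

Lemma sum_fiber_card (T : finType) n (w : 'I_n -> T) : \sum_v fiber_card w v = n.
Proof.
rewrite -[RHS](card_ord n) -sum1_card (partition_big w predT) //=.
by apply: eq_bigr => v _; rewrite sum1dep_card.
Qed.

Lemma sum_porbits (T : finType) (s : {perm T}) (F : {set T} -> nat) :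
  \sum_(O in porbits s) #|O| * F O = \sum_x F (porbit s x).
Proof.
rewrite [RHS](partition_big_imset (porbit s)) /=; apply: eq_bigr => O /imsetP[x _ ->].
rewrite (eq_bigr (fun=> F (porbit s x))) => [|y /eqP-> //].
rewrite sum_nat_const; congr (_ * _); apply: eq_card => y.
by rewrite -eq_porbit_mem.
Qed.

Lemma ncyclesM n (s : 'S_n) i : ncycles s i * i = #|[set x | #|porbit s x| == i]|.
Proof.
rewrite -[RHS]sum1dep_card big_mkcond /=.
rewrite -(sum_porbits s (fun O => (#|O| == i) : nat)) /ncycles -sum1dep_card.
rewrite big_distrl /= [LHS]big_mkcondr; apply: eq_bigr => O _.
by case: eqP => [->|_]; rewrite ?mul1n ?muln1 ?muln0.
Qed.

(** If T moved a point up, all further iterates would go up and never come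
    back; likewise for a point moved down. *)
Lemma increasing_fix n (T : 'S_n) (I : {set 'I_n}) :
  {in I, forall x, T x \in I} -> {in I &, forall x y : 'I_n, x < y -> T x < T y} ->
  {in I, forall x, T x = x}.
Proof.
move=> TI Tlt x xI.
have iterI k : (T ^+ k)%g x \in I.
  by elim: k => [|k IH]; rewrite ?perm1 // expgSr permM TI.
have [k Ek] : exists k, (T ^+ k.+1)%g x = x.
  by exists #|porbit T x|.-1; rewrite prednK ?lt0n ?card_porbit_neq0 // permX iter_porbit.
case: (ltngtP (T x) x) => [lt|lt|/val_inj //].
  have step k' : (T ^+ k'.+1)%g x < (T ^+ k')%g x.
    elim: k' => [|k' IH]; first by rewrite perm1 expg1.
    by rewrite [in X in X < _]expgSr [in X in _ < X]expgSr !permM Tlt.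
  have : (T ^+ k.+1)%g x < x.
    by elim: {Ek} k => [|k IH]; [rewrite expg1 | apply: ltn_trans (step _) IH].
  by rewrite Ek ltnn.
have step k' : (T ^+ k')%g x < (T ^+ k'.+1)%g x.
  elim: k' => [|k' IH]; first by rewrite perm1 expg1.
  by rewrite [in X in X < _]expgSr [in X in _ < X]expgSr !permM Tlt.
have : x < (T ^+ k.+1)%g x.
  by elim: {Ek} k => [|k IH]; [rewrite expg1 | apply: ltn_trans IH (step _)].
by rewrite Ek ltnn.
Qed.

Lemma decreasing_involution n (T : 'S_n) (I : {set 'I_n}) :
  {in I, forall x, T x \in I} -> {in I &, forall x y : 'I_n, x < y -> T y < T x} ->
  {in I, forall x, T (T x) = x}.
Proof.
move=> TI Tgt x xI; have := @increasing_fix _ (T * T)%g I.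
rewrite -permM; apply=> // [y yI|y z yI zI yz]; rewrite !permM; first by rewrite !TI.
by rewrite !Tgt ?TI.
Qed.

(** An order-reversing permutation is an involution with at most one fixed
    point; its other points come in pairs, one moved up and one moved
    down. *)
Lemma card_decreasing_fix n (T : 'S_n) (I : {set 'I_n}) :
  {in I, forall x, T x \in I} -> {in I &, forall x y : 'I_n, x < y -> T y < T x} ->
  #|[set x in I | T x == x]| = odd #|I| :> nat.
Proof.
move=> TI Tgt; have TT := decreasing_involution TI Tgt.
set Fx := [set x in I | T x == x].
have Fx1 : #|Fx| <= 1.
  apply/card_le1_eqP => x y; rewrite !inE => /andP[xI /eqP Tx] /andP[yI /eqP Ty].
  apply: val_inj; case: (ltngtP x y) => // lt.
    by have := Tgt _ _ xI yI lt; rewrite Tx Ty ltnNge ltnW.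
  by have := Tgt _ _ yI xI lt; rewrite Tx Ty ltnNge ltnW.
pose Up := [set x in I | x < T x]; pose Dn := [set x in I | T x < x].
have UD : #|Up| = #|Dn|.
  rewrite -(card_imset Up (@perm_inj _ T)); apply: eq_card => y.
  apply/imsetP/idP => [[x]|].
    by rewrite !inE => /andP[xI lt] ->; rewrite TI // TT.
  rewrite inE => /andP[yI lt]; exists (T y); last by rewrite TT.
  by rewrite inE TI // TT.
have EI : #|I| = #|Fx| + (#|Up| + #|Dn|).
  rewrite -(cardsID [set x | T x == x] I).
  rewrite -(cardsID [set x : 'I_n | x < T x] (I :\: _)).
  congr (_ + (_ + _)); apply: eq_card => x; rewrite !inE //.
    by rewrite -(inj_eq val_inj) /=; case: ltngtP; rewrite ?andbT ?andbF.
  by rewrite -(inj_eq val_inj) /=; case: ltngtP; rewrite ?andbT ?andbF.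
rewrite EI UD addnn oddD odd_double addbF.
by case: #|Fx| Fx1 => [|[|]].
Qed.

(** The number of cycles of length i above a necklace of length p whose
    words have c points each. The return map is the identity, with c
    cycles of length p, or reverses a chain of c points, with c./2 cycles
    of length 2p and a fixed middle point for odd c. *)
Definition cycles_over (p : nat) (neg : bool) (c i : nat) : nat :=
  if neg then (i == p) * odd c + (i == 2 * p) * c./2 else (i == p) * c.

Section CycleType.
Variables (n m l : nat).
Hypothesis dvd_fact : n`! %| l.+1.
Notation word := {ffun 'I_l.+1 -> 'I_m}.
Notation sigma := (rotation m l).
Variables (s : 'S_n) (f : {ffun 'I_n -> 'I_m}).
Hypothesis sf : compat s f.
Local Notation itin := (@itin n m l s f).

Lemma fiber_return (v : word) x : itin x = v -> itin ((s ^+ period v)%g x) = v.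
Proof.
move=> xv; rewrite itin_iter // xv; apply/eqP.
by rewrite porbit_dvdn.
Qed.

Lemma period_dvd_cycle x : period (itin x) %| #|porbit s x|.
Proof. by rewrite -porbit_dvdn -itin_iter // permX iter_porbit. Qed.

(** Counting the points that lie on cycles of a given length avoids
    choosing representatives of the cycles: a cycle over a necklace of
    length p meets the fiber of each of its words in a p-th of its points. *)
Lemma card_fiber_cycles (v : word) i :
  #|[set x | (itin x == v) && (#|porbit s x| == i)]| * period v =
  i * cycles_over (period v) (negative v) (fiber_card itin v) i.
Proof.
set p := period v; have p0 : 0 < p by apply: period_gt0.
pose I := [set x | itin x == v]; pose T := (s ^+ p)%g.
have TI : {in I, forall x, T x \in I}.
  by move=> x; rewrite !inE => /eqP xv; rewrite /T fiber_return.
have Tord : {in I &, forall x y : 'I_n, x < y -> (T x < T y) = ~~ negative v}.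
  move=> x y; rewrite !inE => /eqP xv /eqP yv xy.
  rewrite /T (iter_order dvd_fact sf) ?xv ?yv ?xy //; last first.
    by case: eqP xy => // ->; rewrite ltnn.
have T_cycle x : x \in I -> T x = x -> #|porbit s x| = p.
  rewrite inE => /eqP xv /eqP; rewrite porbit_dvdn => qp.
  by apply/eqP; rewrite eqn_dvd qp /=; have := period_dvd_cycle x; rewrite xv.
have -> : [set x | (itin x == v) && (#|porbit s x| == i)] =
    [set x in I | #|porbit s x| == i] by apply/setP => x; rewrite !inE.
have itI x : x \in I -> itin x = v by rewrite inE => /eqP.
rewrite /cycles_over /fiber_card -/I; clearbody I; case: ifP => nv.
  have Tgt : {in I &, forall x y : 'I_n, x < y -> T y < T x}.
    move=> x y xI yI xy; have := Tord x y xI yI xy; rewrite nv /=.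
    case: ltngtP => // /val_inj/perm_inj exy.
    by rewrite exy ltnn in xy.
  have TT := decreasing_involution TI Tgt; have cF := card_decreasing_fix TI Tgt.
  have T_cycle2 x : x \in I -> T x != x -> #|porbit s x| = 2 * p.
    move=> xI nTx; have := TT x xI; rewrite -permM -expgD => /eqP.
    rewrite porbit_dvdn addnn -mul2n.
    have := period_dvd_cycle x; rewrite (itI x xI).
    case/dvdnP => r Er; move: nTx; rewrite porbit_dvdn Er dvdn_pmul2r //.
    rewrite -/p -[X in _ %| X]mul1n dvdn_pmul2r // dvdn1 => r1 r2.
    by rewrite (prime_nt_dvdP _ _ r2).
  have -> : #|[set x in I | #|porbit s x| == i]| =
      (i == p) * #|[set x in I | T x == x]| +
      (i == 2 * p) * #|[set x in I | T x != x]|.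
    rewrite -!sum1dep_card !big_distrr /= (bigID (fun x => T x == x)) /=.
    rewrite !(big_mkcond (fun x => _ && _)) /=; congr (_ + _); apply: eq_bigr => x _.
      have [xI|//] /= := boolP (x \in I); case: (boolP (T x == x)) => Tx; rewrite ?andbF //.
      by rewrite T_cycle // ?(eqP Tx) // eq_sym andbT; case: eqP.
    have [xI|//] /= := boolP (x \in I); case: (boolP (T x == x)) => Tx; rewrite ?andbF //.
    by rewrite T_cycle2 // eq_sym andbT; case: eqP.
  have -> : #|[set x in I | T x != x]| = #|I| - odd #|I|.
    rewrite -cF -(cardsID [set x | T x == x] I).
    have -> : [set x in I | T x == x] = I :&: [set x | T x == x].
      by apply/setP=> x; rewrite !inE.
    by rewrite addKn; apply: eq_card => x; rewrite !inE andbC.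
  rewrite cF -[X in X - _]odd_double_half addKn -mul2n.
  have e1 : (i == p) * p = i * (i == p) by case: eqP => [->|]; rewrite ?mul1n ?muln1 ?muln0.
  have e2 : (i == 2 * p) * (2 * p) = i * (i == 2 * p).
    by case: eqP => [->|]; rewrite ?mul1n ?muln1 ?muln0.
  rewrite mulnDl mulnDr; congr (_ + _); first by rewrite mulnAC e1 mulnA.
  by rewrite [RHS]mulnA -e2; ring.
have Tid : {in I, forall x, T x = x}.
  apply: increasing_fix => // x y xI yI xy.
  by rewrite Tord // nv.
have -> : [set x in I | #|porbit s x| == i] = if i == p then I else set0.
  apply/setP => x; have -> : (x \in if i == p then I else set0) = (i == p) && (x \in I).
    by case: ifP; rewrite ?inE.
  rewrite inE; have [xI|] := boolP (x \in I); last by rewrite andbF.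
  by rewrite T_cycle ?Tid // eq_sym andbT.
by case: eqP => [->|_]; rewrite ?cards0 ?muln0 ?mul0n ?muln0 // mul1n mulnC.
Qed.

End CycleType.

Section Multiplicities.
Variables (n m l : nat).
Hypothesis dvd_fact : n`! %| l.+1.
Notation word := {ffun 'I_l.+1 -> 'I_m}.
Notation sigma := (rotation m l).
Notation necklaces := (porbits sigma).
Notation multiset := {ffun {set word} -> 'I_n.+1}.
Implicit Types (s : 'S_n) (f : {ffun 'I_n -> 'I_m}) (g : multiset).
Local Notation itin := (@itin n m l).

Definition multiplicity s f : multiset :=
  [ffun O => if O \in necklaces
             then inord (#|[set i | itin s f i \in O]| %/ #|O|) else ord0].

Lemma fiber_card_shift s f v :
  fiber_card (itin s f) (shift v) = fiber_card (itin s f) v.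
Proof.
rewrite /fiber_card -[RHS](card_imset _ (@perm_inj _ s)); apply: eq_card => i.
rewrite !inE; apply/eqP/imsetP => [e|[j]].
  exists (s^-1 i)%g; rewrite ?permKV // inE; apply/eqP/(@shift_inj m l).
  by rewrite -itin_next // permKV.
by rewrite inE => /eqP <- ->; rewrite itin_next.
Qed.

Lemma fiber_card_orbit s f u v : u \in porbit sigma v ->
  fiber_card (itin s f) u = fiber_card (itin s f) v.
Proof.
case/porbitP => k ->; elim: k => [|k IH]; first by rewrite perm1.
by rewrite expgSr permM permE fiber_card_shift.
Qed.

Lemma multiplicity_porbit s f v :
  multiplicity s f (porbit sigma v) = fiber_card (itin s f) v :> nat.
Proof.
rewrite ffunE imset_f //.
have -> : #|[set i | itin s f i \in porbit sigma v]| =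
    (fiber_card (itin s f) v * #|porbit sigma v|)%N.
  rewrite -sum1dep_card (partition_big (itin s f) (mem (porbit sigma v))) //= mulnC.
  rewrite -sum_nat_const; apply: eq_bigr => u uv; rewrite -(fiber_card_orbit _ _ uv).
  rewrite sum1dep_card; apply: eq_card => i; rewrite !inE andbC.
  by case: eqP => // ->.
rewrite mulnK ?lt0n ?card_porbit_neq0 // inordK // ltnS -[n in _ <= n]card_ord.
exact: max_card.
Qed.

Lemma sum_multiplicity s f : \sum_(O in necklaces) #|O| * multiplicity s f O = n.
Proof.
rewrite sum_porbits -[RHS](sum_fiber_card (itin s f)).
by apply: eq_bigr => v _; rewrite multiplicity_porbit.
Qed.

Definition supported g := g \in pffun_on ord0 (mem necklaces) predT.

Lemma supportedP g : reflect (forall O, O \notin necklaces -> g O = ord0) (supported g).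
Proof.
apply: (iffP pffun_onP) => [[/supportP H _] O nO|H]; first exact: H.
by split; [apply/supportP | move=> ?].
Qed.

Lemma ncyclesE s f i : compat s f -> 0 < i ->
  ncycles s i = \sum_(O in necklaces)
    cycles_over #|O| (negative_necklace O) (multiplicity s f O) i.
Proof.
move=> sf i0; apply/eqP; rewrite -(eqn_pmul2l i0) mulnC ncyclesM; apply/eqP.
pose Y (O : {set word}) := i * cycles_over #|O| (negative_necklace O) (multiplicity s f O) i.
have YE v : #|[set x | (itin s f x == v) && (#|porbit s x| == i)]| * #|porbit sigma v| =
    Y (porbit sigma v).
  by rewrite (card_fiber_cycles dvd_fact sf) /Y negative_necklaceE multiplicity_porbit.
rewrite big_distrr /= (eq_bigr (fun O : {set word} => #|O| * (Y O %/ #|O|))); last first.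
  move=> O /imsetP[v _ ->]; rewrite [RHS]mulnC divnK // -YE; exact: dvdn_mull.
rewrite (sum_porbits sigma (fun O => Y O %/ #|O|)).
rewrite -sum1dep_card (partition_big (itin s f) predT) //=.
apply: eq_bigr => v _; rewrite -YE mulnK ?lt0n ?card_porbit_neq0 // sum1dep_card.
by apply: eq_card => x; rewrite !inE andbC.
Qed.

(** Multiplicities are constant on necklaces and have sum n. They
    determine the compatible pair by compat_unique and are otherwise
    arbitrary by compat_exists. *)
Lemma sum_compat (V : nmodType) (F : multiset -> V) :
  (\sum_(s : 'S_n) \sum_(f | compat s f) F (multiplicity s f) =
   \sum_(g | supported g && (\sum_(O in necklaces) #|O| * g O == n)%N) F g)%R.
Proof.
rewrite pair_big_dep /=.
pose A := [set p : 'S_n * {ffun 'I_n -> 'I_m} | compat p.1 p.2].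
pose Phi (p : 'S_n * {ffun 'I_n -> 'I_m}) := multiplicity p.1 p.2.
have PhiE p v : fiber_card (itin p.1 p.2) v = Phi p (porbit sigma v).
  by rewrite -multiplicity_porbit.
have Phi_inj : {in A &, injective Phi}.
  move=> [s f] [s' f']; rewrite !inE /= => sf sf' e.
  apply: (compat_unique dvd_fact) => // v.
  by rewrite (PhiE (s, f)) e -(PhiE (s', f')).
transitivity (\sum_(g in Phi @: A) F g)%R.
  by rewrite big_imset //=; apply: eq_bigl => p; rewrite inE.
apply: eq_bigl => g; apply/imsetP/andP => [[[s f] _ ->]|[/supportedP sup /eqP sg]].
  split; last by rewrite sum_multiplicity.
  by apply/supportedP => O /negbTE nO; rewrite ffunE nO.
have [||s [f [sf cf]]] := compat_exists dvd_fact (c := fun v => g (porbit sigma v)).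
- by rewrite -[RHS]sg sum_porbits.
- move=> v; congr (val (g _)); apply/eqP; rewrite eq_porbit_mem.
  by have := mem_porbit sigma 1 v; rewrite expg1 permE.
exists (s, f); first by rewrite inE.
apply/ffunP => O; apply: val_inj; have [/imsetP[v _ ->]|nO] := boolP (O \in necklaces).
  by rewrite /= multiplicity_porbit cf.
by rewrite sup // ffunE (negbTE nO).
Qed.

Local Open Scope ring_scope.

Definition necklace_weight (R : comNzRingType) (z : nat -> R) p (neg : bool) c : R :=
  if neg then z p ^+ odd c * z (2 * p)%N ^+ c./2 else z p ^+ c.

Lemma prod_cycles_over (R : comNzRingType) (z : nat -> R) p neg c N :
  (0 < p)%N -> (p * c <= N)%N ->
  \prod_(1 <= i < N.+1) z i ^+ cycles_over p neg c i = necklace_weight z p neg c.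
Proof.
move=> p0 pcN.
have prod1 q a : (0 < q)%N -> ((0 < a) ==> (q <= N))%N ->
    \prod_(1 <= i < N.+1) z i ^+ ((i == q) * a) = z q ^+ a.
  move=> q0; have [-> _|a0 /= qN] := posnP a.
    by rewrite expr0 big1 // => i _; rewrite muln0 expr0.
  rewrite (bigD1_seq q) ?mem_index_iota ?iota_uniq ?q0 ?ltnS //= eqxx mul1n.
  by rewrite big1 ?mulr1 // => i /negbTE ->; rewrite mul0n expr0.
rewrite /necklace_weight /cycles_over; case: neg; last first.
  by rewrite prod1 //; apply/implyP => c0; apply: leq_trans pcN; rewrite leq_pmulr.
have c1 : ((0 < odd c) ==> (p <= N))%N.
  by case: (c) pcN => //= c' pcN; apply/implyP => _; apply: leq_trans pcN; rewrite leq_pmulr.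
have c2 : ((0 < c./2) ==> (2 * p <= N))%N.
  by case: (c) pcN => [|[|c']] //= pcN; apply: leq_trans pcN; rewrite mulnC leq_mul2l orbT.
under eq_bigr => i _ do rewrite exprD.
by rewrite big_split /= !prod1 // muln_gt0.
Qed.

Lemma sum_labelled_cycle_type (R : comNzRingType) (z : nat -> R) :
  \sum_(s : 'S_n) \sum_(f : {ffun 'I_n -> 'I_m} | compat s f)
     \prod_(1 <= i < n.+1) z i ^+ ncycles s i =
  \sum_(g : multiset | supported g && (\sum_(O in necklaces) #|O| * g O == n)%N)
     \prod_(O in necklaces) necklace_weight z #|O| (negative_necklace O) (g O).
Proof.
rewrite -(sum_compat (fun g => \prod_(O in necklaces)
  necklace_weight z #|O| (negative_necklace O) (g O))).
apply: eq_bigr => s _; apply: eq_bigr => f sf.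
transitivity (\prod_(1 <= i < n.+1) \prod_(O in necklaces)
    z i ^+ cycles_over #|O| (negative_necklace O) (multiplicity s f O) i).
  rewrite big_seq [RHS]big_seq; apply: eq_bigr => i; rewrite mem_index_iota => /andP[i0 _].
  by rewrite (ncyclesE sf i0) prodrXr.
rewrite exchange_big; apply: eq_bigr => O OP; apply: prod_cycles_over.
  by case/imsetP: OP => v _ ->; rewrite lt0n card_porbit_neq0.
rewrite -[X in (_ <= X)%N](sum_multiplicity s f) (bigD1 O) //=.
exact: leq_addr.
Qed.
End Multiplicities.

Local Open Scope ring_scope.

(** * The generating function of the labellings *)

Section SeriesBasics.
Variable R : comNzRingType.
Implicit Types f g : fps R.
Local Notation X := (fpsX R).

Lemma coefD_fps f g n : (f + g) n = f n + g n. Proof. by []. Qed.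
Lemma coefN_fps f n : (- f) n = - f n. Proof. by []. Qed.
Lemma coefM_fps f g n : (f * g) n = \sum_(i < n.+1) f i * g (n - i)%N. Proof. by []. Qed.
Lemma coef1_fps n : (1 : fps R) n = (n == 0%N)%:R. Proof. by case: n. Qed.

Lemma coef_sum_fps (I : Type) (r : seq I) (P : pred I) (F : I -> fps R) n :
  (\sum_(i <- r | P i) F i) n = \sum_(i <- r | P i) F i n.
Proof. by elim/big_rec2: _ => // i x y _ <-. Qed.

Lemma coefCM_fps c f n : (fpsC c * f) n = c * f n.
Proof.
rewrite coefM_fps big_ord_recl /= subn0 big1 ?addr0 // => i _.
by rewrite mul0r.
Qed.

Lemma coefXM_fps f n : (X * f) n = if n is n'.+1 then f n' else 0.
Proof.
rewrite coefM_fps; case: n => [|n].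
  by rewrite big_ord_recl big_ord0 addr0; exact: mul0r.
rewrite 2!big_ord_recl big1 => [|i _]; last exact: mul0r.
by rewrite /= mul0r add0r mul1r addr0 /bump subSS subn0.
Qed.

Lemma coefXnM_fps k f n : (X ^+ k * f) n = if (k <= n)%N then f (n - k)%N else 0.
Proof.
elim: k n => [|k IH] n; first by rewrite expr0 mul1r subn0.
by rewrite exprS -mulrA coefXM_fps; case: n => [|n] //; rewrite IH.
Qed.

Lemma fpsC_is_zmod_morphism : zmod_morphism (@fpsC R).
Proof. by move=> a b; apply: fpsP => -[|n] //=; rewrite subr0. Qed.

Lemma fpsC_is_monoid_morphism : monoid_morphism (@fpsC R).
Proof.
split=> // a b; apply: fpsP => n; rewrite coefCM_fps /=.
by case: (n == 0%N); rewrite ?mulr0.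
Qed.

HB.instance Definition _ :=
  GRing.isZmodMorphism.Build R (fps R) (@fpsC R) fpsC_is_zmod_morphism.
HB.instance Definition _ :=
  GRing.isMonoidMorphism.Build R (fps R) (@fpsC R) fpsC_is_monoid_morphism.

Lemma fps_unit_one f : f 0%N = 1 -> f \is a GRing.unit.
Proof. by move=> f0; apply/fps_unitP; exists 1; rewrite f0 mulr1. Qed.

Definition label_series b n : fps R := FPS (fun j => (last_label b n j)%:R).

Definition labellings_series b n : fps R :=
  FPS (fun m => (\sum_(j < m) last_label b n j)%:R).

Lemma label_seriesS b n :
  (1 - X ^+ 2) * label_series b n.+1 =
  (if b n == direction b n then 1 + X ^+ 2 else X *+ 2) * label_series b n.
Proof.
have b0 : last_label b n.+1 0 = (b n * last_label b n 0)%N.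
  by rewrite last_labelS big_ord0 addbF.
have b1 : last_label b n.+1 1 = (last_label b n 0 + ~~ b n * last_label b n 1)%N.
  by rewrite last_labelS big_ord1 addbT.
have flat := @last_label_flat b n 0; have bot := @last_label_bottom b n.
apply: fpsP => j; rewrite mulrBl mul1r coefD_fps coefN_fps coefXnM_fps.
case: eqVneq => bn.
  rewrite mulrDl mul1r coefD_fps coefXnM_fps; move: flat bot; rewrite -bn addbF.
  case: j => [|[|j]] /= flat bot; rewrite ?subr0 ?addr0.
  - by rewrite b0; case: (b n) bot => [_|->] //; rewrite mul1n.
  - rewrite b1; case: (b n) flat bot => [-> // _|_ -> //].
      by rewrite mul0n addn0.
    by rewrite mul1n.
  - by rewrite !subSS subn0 (last_label_same _ bn) !natrD; ring.
rewrite mulrnAl mulr2n coefD_fps coefXM_fps.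
have dn : direction b n = ~~ b n by case: (b n) bn => /=; case: direction.
rewrite dn addbF negbK in flat bot.
case: j => [|[|j]] /=; rewrite ?subr0 ?addr0.
- by rewrite b0; case: (b n) bot => [->|_].
- rewrite b1; case: (b n) flat bot => [_ -> //|-> // _].
    by rewrite mul0n addr0.
  by rewrite /= mul1n natrD.
by rewrite !subSS subn0 (last_label_change _ bn) mul2n -addnn !natrD; ring.
Qed.

(** Each position contributes a factor 1 + X^2 or 2X according to whether
    the direction persists or changes there. *)
Lemma label_seriesE b n :
  (1 - X) * (1 - X ^+ 2) ^+ n * label_series b n * (1 + X ^+ 2) ^+ changes b n =
  (1 + X ^+ 2) ^+ n * (X *+ 2) ^+ changes b n.
Proof.
elim: n => [|n IH].
  rewrite /changes big_ord0 !expr0 !mulr1; apply: fpsP => j.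
  rewrite mulrBl mul1r coefD_fps coefN_fps coefXM_fps coef1_fps.
  by case: j => [|j]; rewrite ?subr0 ?subrr.
(* The factors are abstracted so that ring treats their powers as atoms. *)
have -> : changes b n.+1 = ((b n != direction b n) + changes b n)%N.
  by rewrite /changes big_ord_recr addnC.
move: IH (label_seriesS b n); move: (1 - X ^+ 2) (1 + X ^+ 2) (X *+ 2) => A B C.
move: (label_series b n.+1) (label_series b n) => T' T IH step.
rewrite !exprS; transitivity ((1 - X) * A ^+ n * B ^+ changes b n *
    B ^+ (b n != direction b n) * (A * T')); first by rewrite exprD; ring.
rewrite step.
transitivity ((1 - X) * A ^+ n * T * B ^+ changes b n *
    (B * C ^+ (b n != direction b n))).
  by case: eqVneq => _; rewrite /= ?expr0 ?expr1; ring.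
by rewrite IH exprD; ring.
Qed.

Lemma labellings_seriesE b n :
  (1 - X) * labellings_series b n = X * label_series b n.
Proof.
apply: fpsP => j; rewrite mulrBl mul1r coefD_fps coefN_fps !coefXM_fps /=.
case: j => [|j]; first by rewrite big_ord0 subr0.
by rewrite big_ord_recr /= natrD addrAC subrr add0r.
Qed.

End SeriesBasics.

(** * Odd Moebius inversion *)

Section BigMultiples.
Variables (T : Type) (idx : T) (op : Monoid.com_law idx).

Lemma big_ord_pred1 (N k : nat) (c : T) :
  \big[op/idx]_(d < N) (if d == k :> nat then c else idx) =
  if (k < N)%N then c else idx.
Proof.
case: ltnP => kN.
  rewrite (bigD1 (Ordinal kN)) //= eqxx big1 ?Monoid.mulm1 // => d ndk.
  by case: eqP => // dk; case/eqP: ndk; apply: val_inj.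
by rewrite big1 // => d _; case: eqP => // dk; have := ltn_ord d; rewrite dk ltnNge kN.
Qed.

Lemma big_multiples (p N : nat) (F : nat -> T) : (0 < p)%N ->
  \big[op/idx]_(d < N | (p %| d)%N) F d =
  \big[op/idx]_(e < N | (p * e < N)%N) F (p * e)%N.
Proof.
move=> p0; rewrite big_mkcond [RHS]big_mkcond /=.
transitivity (\big[op/idx]_(d < N) \big[op/idx]_(e < N)
    if d == (p * e)%N :> nat then F (p * e)%N else idx).
  apply: eq_bigr => d _; case: ifP => pd; last first.
    rewrite big1 // => e _; case: eqP => // de.
    by rewrite de dvdn_mulr in pd.
  rewrite (eq_bigr (fun e : 'I_N => if e == (d %/ p)%N :> nat then F d else idx)).
    by rewrite big_ord_pred1 (leq_ltn_trans (leq_div _ _)).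
  move=> e _; rewrite -{1}(divnK pd) mulnC eqn_pmul2l // eq_sym.
  by case: eqP => // ->; rewrite mulnC divnK.
by rewrite exchange_big; apply: eq_bigr => e _; rewrite big_ord_pred1.
Qed.
End BigMultiples.

Lemma moebius_primeM (p d : nat) : prime p -> (0 < d)%N ->
  moebius (p * d) = if (p %| d)%N then 0 else - moebius d.
Proof.
move=> pr_p d0; have p0 := prime_gt0 pr_p.
case: ifP => pd.
  rewrite /moebius; case: allP => // /(_ p); rewrite mem_primes pr_p muln_gt0 p0 d0 dvdn_mulr //.
  move=> /(_ isT); rewrite lognM // logn_prime // eqxx add1n eqSS -leqn0 leqNgt.
  by rewrite logn_gt0 mem_primes pr_p d0 pd.
have E : perm_eq (primes (p * d)) (p :: primes d).
  apply: uniq_perm; rewrite ?primes_uniq //=.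
    by rewrite mem_primes pd !andbF primes_uniq.
  by move=> q; rewrite primesM // primes_prime // inE.
rewrite /moebius (perm_size E) (perm_all _ E) /= lognM // logn_prime // eqxx.
rewrite (_ : logn p d = 0%N) ?addn0 ?eqxx /=; last first.
  by apply/eqP; rewrite -leqn0 leqNgt logn_gt0 mem_primes pd !andbF.
rewrite (eq_in_all (a2 := fun q => logn q d == 1%N)); last first.
  move=> q qd; rewrite lognM // logn_prime //.
  have [eqp|_] := eqVneq p q; rewrite ?add0n //.
  by move: qd; rewrite -eqp mem_primes pd !andbF.
by case: ifP => _; rewrite ?oppr0 // exprS mulN1r.
Qed.

Lemma is_pow2P i : reflect (exists j, i = (2 ^ j)%N) (is_pow2 i).
Proof.
apply: (iffP existsP) => [[j /eqP ->]|[j ->]]; first by exists j.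
by exists (Ordinal (ltn_expl j (ltnSn 1))) => /=.
Qed.

Lemma is_pow2_odd i : odd i -> is_pow2 i = (i == 1%N).
Proof.
move=> oi; apply/is_pow2P/eqP => [[[|j] E]|->]; last by exists 0%N.
  by rewrite E.
by move: oi; rewrite E expnS oddM.
Qed.

Lemma pow2_or_odd_prime i : (0 < i)%N ->
  is_pow2 i \/ exists p, [/\ prime p, odd p & (p %| i)%N].
Proof.
move=> i0; have [/hasP[p]|/hasPn H] := boolP (has odd (primes i)).
  by rewrite mem_primes => /and3P[pp _ pi] op; right; exists p.
left; apply/is_pow2P; exists (logn 2 i); rewrite -p_part part_pnat_id //.
apply/pnatP => // p pp pi; have := H p; rewrite mem_primes pp i0 pi => /(_ isT).
by case: (even_prime pp) => [->|->].
Qed.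

(** If an odd prime p divides n, multiplication by p pairs the odd
    divisors of n that are prime to p with those divisible by p exactly
    once, and the signs are opposite. Otherwise 1 is the only odd divisor. *)
Lemma sum_moebius_odd n : (0 < n)%N ->
  \sum_(d < n.+1 | (d %| n)%N && odd d) moebius d = (is_pow2 n)%:R.
Proof.
move=> n0; case: (boolP (is_pow2 n)) => [/is_pow2P[j nj]|np].
  rewrite (big_pred1 (inord 1)) => [|d]; first by rewrite inordK.
  rewrite /=; have [->|d1] := eqVneq d (inord 1).
    by rewrite inordK // dvd1n.
  apply/negP => /andP[]; rewrite [X in (_ %| X)%N]nj.
  case/dvdn_pfactor=> // -[|k] _ Ed; last by rewrite Ed expnS oddM.
  by case/eqP: d1; apply: val_inj; rewrite /= Ed inordK.
case: (pow2_or_odd_prime n0) => [|[p [pr_p op pn]]]; first by rewrite (negbTE np).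
have p0 := prime_gt0 pr_p.
rewrite (bigID (fun d : 'I_n.+1 => (p %| d)%N)) /= addrC.
have -> : \sum_(d < n.+1 | [&& (d %| n)%N && odd d & (p %| d)%N]) moebius d =
    \sum_(d < n.+1 | (p %| d)%N) (if (d %| n)%N && odd d then moebius d else 0).
  rewrite big_mkcond [RHS]big_mkcond; apply: eq_bigr => d _.
  by case: (p %| d)%N; rewrite ?andbT ?andbF.
rewrite (@big_multiples _ _ _ p n.+1 (fun d => if (d %| n)%N && odd d then moebius d else 0)) //.
rewrite big_mkcond [X in _ + X]big_mkcond -big_split big1 //= => e _.
have [->|e0] := posnP e; first by rewrite muln0 dvd0n gtn_eqF // if_same addr0.
rewrite moebius_primeM // oddM op /= ltnS; case: (boolP (p %| e)%N) => pe /=.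
  by rewrite andbF !if_same addr0.
rewrite andbT Gauss_dvd ?prime_coprime // pn /=.
case: ifP => [/andP[en oe]|_]; last by rewrite if_same addr0.
have pen : (p * e %| n)%N by rewrite Gauss_dvd ?prime_coprime // pn.
by rewrite (dvdn_leq n0 pen) subrr.
Qed.

(** The odd divisors d of i for which p is an odd-quotient divisor of i/d
    are the divisors of i/p if i/p is odd, and there are none otherwise. *)
Lemma sum_moebius_quotients i p : (0 < i)%N -> (p %| i)%N ->
  \sum_(d < i.+1 | [&& (d %| i)%N, odd d, (p %| i %/ d)%N & odd (i %/ d %/ p)]) moebius d
  = (p == i)%:R.
Proof.
move=> i0 pi; have p0 := dvdn_gt0 i0 pi.
have [oq|nq] := boolP (odd (i %/ p)); last first.
  rewrite big_pred0 => [|d].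
    by rewrite [p == i](introF eqP) // => pi'; move: nq; rewrite pi' divnn i0.
  apply/negP => /and4P[di od pid oip]; move: nq.
  by rewrite -(divnK di) -(divnK pid) mulnAC mulnK // oddM oip od.
rewrite (eq_bigl (fun d : 'I_i.+1 => (d %| i %/ p)%N && odd d)) => [|d]; last first.
  apply/and4P/andP => [[di od pid oip]|[dip od]].
    have E : (i %/ p = i %/ d %/ p * d)%N.
      by rewrite -{1}(divnK di) -{1}(divnK pid) mulnAC mulnK.
    by rewrite E dvdn_mull.
  have d0 : (0 < d)%N by case: (val d) od.
  have E : (i = i %/ p %/ d * p * d)%N by rewrite mulnAC divnK ?divnK.
  have di : (d %| i)%N by apply/dvdnP; exists (i %/ p %/ d * p)%N.
  have Eq : (i %/ d = i %/ p %/ d * p)%N by rewrite {1}E mulnK.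
  split=> //; rewrite Eq ?dvdn_mull // mulnK //.
  by move: oq; rewrite -{1}(divnK dip) oddM => /andP[].
have q0 : (0 < i %/ p)%N by rewrite divn_gt0 // dvdn_leq.
have := sum_moebius_odd q0; rewrite (is_pow2_odd oq).
have -> : (i %/ p == 1)%N = (p == i).
  apply/eqP/eqP => [E|->]; last by rewrite divnn i0.
  by rewrite -[RHS](divnK pi) E mul1n.
move=> <-; rewrite (@big_ord_widen_cond _ _ _ (i %/ p).+1 i.+1
  (fun d => (d %| i %/ p)%N && odd d) moebius) ?ltnS ?leq_div //.
apply: eq_bigl => d; case: (boolP (d %| i %/ p)%N) => //= dip.
by rewrite ltnS (dvdn_leq q0 dip) andbT.
Qed.

Lemma moebius_odd_inversion (N : nat) (F B : nat -> int) :
  (forall i, (0 < i <= N)%N ->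
    \sum_(p < i.+1 | (p %| i)%N && odd (i %/ p)) B p = F i) ->
  forall i, (0 < i <= N)%N ->
    \sum_(d < i.+1 | (d %| i)%N && odd d) moebius d * F (i %/ d)%N = B i.
Proof.
move=> FB i /andP[i0 iN].
transitivity (\sum_(d < i.+1 | (d %| i)%N && odd d)
   \sum_(p < i.+1 | (p %| i)%N && ((p %| i %/ d)%N && odd (i %/ d %/ p))) moebius d * B p).
  apply: eq_bigr => d /andP[di od].
  have d0 := dvdn_gt0 i0 di.
  have q0 : (0 < i %/ d)%N by rewrite divn_gt0 // dvdn_leq.
  rewrite -FB; last by rewrite q0 (leq_trans (leq_div _ _) iN).
  rewrite (@big_ord_widen_cond _ _ _ (i %/ d).+1 i.+1
    (fun p => (p %| i %/ d)%N && odd (i %/ d %/ p)) B) ?ltnS ?leq_div //.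
  rewrite mulr_sumr; apply: eq_bigl => p.
  case: (boolP (p %| i %/ d)%N) => //= pid; rewrite ?andbF //.
  by rewrite (dvdn_trans pid) ?dvdn_div //= ltnS (dvdn_leq q0 pid) andbT.
rewrite (@exchange_big_dep _ _ _ _ _ _ _ _ _ (fun p : 'I_i.+1 => (p %| i)%N)) /=; last first.
  by move=> d p _ /andP[].
rewrite (bigD1 ord_max) //= [X in _ + X]big1 ?addr0 => [|p /andP[pi /negbTE np]].
  rewrite -mulr_suml (eq_bigl (fun d : 'I_i.+1 =>
    [&& (d %| i)%N, odd d, (i %| i %/ d)%N & odd (i %/ d %/ i)])).
    by rewrite sum_moebius_quotients // eqxx mul1r.
  by move=> d; rewrite dvdnn -andbA.
rewrite -mulr_suml (eq_bigl (fun d : 'I_i.+1 =>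
    [&& (d %| i)%N, odd d, (p %| i %/ d)%N & odd (i %/ d %/ p)])).
  by rewrite sum_moebius_quotients // -[i]/(val (@ord_max i)) (inj_eq val_inj) np mul0r.
by move=> d; rewrite pi -andbA.
Qed.

(** * The exponents count necklaces *)

Section NecklaceNumbers.
Variables (m l N : nat).
Hypothesis dvd_length : forall i, (0 < i <= N)%N -> (i %| l.+1)%N.
Local Notation P p := (nb_necklaces m l p false).
Local Notation Q p := (nb_necklaces m l p true).

(** A negative necklace of length p, repeated i/p times, is negative
    exactly when i/p is odd. The total count minus the signed count keeps
    these, twice. *)
Lemma nb_negative_odd i : (0 < i <= N)%N ->
  \sum_(p < i.+1 | (p %| i)%N && odd (i %/ p)) (2 * Q p * p)%:R
  = m%:R ^+ i - (odd m)%:R :> int.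
Proof.
move=> iN; have il := dvd_length iN; have /andP[i0 _] := iN.
rewrite -(nb_words_total m i0 il) -(nb_words_signed m i0 il) -sumrB big_mkcondr /=.
apply: eq_bigr => p _; rewrite !nb_necklacesE -signr_odd -mulnA natrM.
by case: odd; rewrite ?expr0 ?expr1; ring.
Qed.

Lemma nb_negativeE i : (0 < i <= N)%N ->
  \sum_(d < i.+1 | (d %| i)%N && odd d)
     moebius d * (m%:R ^+ (i %/ d)%N - (odd m)%:R) = (2 * Q i * i)%:R.
Proof.
exact: (@moebius_odd_inversion N (fun j => m%:R ^+ j - (odd m)%:R)
  (fun p => (2 * Q p * p)%:R) nb_negative_odd).
Qed.

(** In the signed count of the words of period dividing i, a negative
    necklace of length p has sign (-1)^(i/p), which is -1 corrected by 2
    when 2p divides i. So it counts as minus a positive necklace of length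
    p plus one of length 2p. The count of positive necklaces thus
    corrected has the same sums over the divisors of i as the contribution
    of length 1 alone, and induction on i compares the terms. *)
Lemma nb_positiveE i : (0 < i <= N)%N ->
  (P i + (if 2 %| i then Q (i %/ 2)%N else 0) = Q i + (i == 1) * odd m)%N.
Proof.
pose D i : int := (P i)%:R + (if (2 %| i)%N then Q (i %/ 2)%N else 0%N)%:R - (Q i)%:R
  - ((i == 1%N) * odd m)%:R.
suff D0 : forall i, (0 < i <= N)%N -> D i = 0.
  move=> /D0/eqP; rewrite /D -addrA -opprD subr_eq0 -!natrD eqr_nat.
  by move/eqP.
have sumD j : (0 < j <= N)%N -> \sum_(p < j.+1 | (p %| j)%N) D p * p%:R = 0.
  move=> jN; have jl := dvd_length jN; have /andP[j0 _] := jN.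
  have := nb_words_signed m j0 jl; under eq_bigr => p _ do rewrite !nb_necklacesE.
  have -> : (odd m)%:R = \sum_(p < j.+1 | (p %| j)%N) ((p == 1%N :> nat) * odd m)%:R * p%:R :> int.
    have j1 : (1 < j.+1)%N by [].
    rewrite (bigD1 (Ordinal j1)) ?dvd1n //= mulr1 mul1n big1 ?addr0 // => p /andP[_ np].
    by rewrite -(inj_eq val_inj) /= in np; rewrite (negbTE np) mul0r.
  move/eqP; rewrite -subr_eq0 -sumrB => /eqP E.
  transitivity (\sum_(p < j.+1 | (p %| j)%N) (D p * p%:R -
     ((P p * p)%:R + (Q p * p)%:R * (-1) ^+ (j %/ p)%N - ((p == 1%N :> nat) * odd m)%:R * p%:R))).
    by rewrite sumrB E subr0.
  transitivity (\sum_(p < j.+1 | (p %| j)%N) ((if (2 %| p)%N then Q (p %/ 2)%N else 0%N) * p)%:R -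
    \sum_(p < j.+1 | (p %| j)%N) (if (2 * p %| j)%N then 2 * Q p * p else 0%N)%:R : int).
    rewrite -sumrB; apply: eq_bigr => p pj; rewrite /D.
    rewrite -signr_odd.
    have -> : (2 * p %| j)%N = ~~ odd (j %/ p).
      by rewrite -dvdn2 -[X in (_ %| X)%N = _](divnK pj) dvdn_pmul2r // (dvdn_gt0 j0 pj).
    by case: (odd (j %/ p)%N); rewrite /= ?expr0 ?expr1 ?natrM; ring.
  apply/eqP; rewrite subr_eq0; apply/eqP.
  pose G p : int := if (p %| j)%N then (Q (p %/ 2)%N * p)%:R else 0.
  transitivity (\sum_(p < j.+1 | (2 %| p)%N) G p).
    rewrite big_mkcond [RHS]big_mkcond; apply: eq_bigr => p _; rewrite /G.
    by case: (p %| j)%N; case: (2 %| p)%N.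
  rewrite big_multiples // big_mkcond [RHS]big_mkcond; apply: eq_bigr => p _; rewrite /G.
  rewrite mulKn // ltnS.
  have [d2|] := boolP (2 * p %| j)%N.
    by rewrite (dvdn_leq j0 d2) (dvdn_trans _ d2) ?dvdn_mull // mulnCA mulnA.
  by rewrite !if_same.
move=> j; elim/ltn_ind: j => j IH jN; have := sumD j jN; have /andP[j0 jN'] := jN.
rewrite (bigD1 ord_max) //= big1 ?addr0 => [/eqP|p /andP[pj np]].
  by rewrite mulf_eq0 pnatr_eq0 gtn_eqF // orbF => /eqP.
have p0 := dvdn_gt0 j0 pj.
have lt_pj : (p < j)%N by rewrite ltn_neqAle dvdn_leq // andbT -(inj_eq val_inj) in np *.
by rewrite IH ?mul0r // p0 (leq_trans (ltnW lt_pj)).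
Qed.
End NecklaceNumbers.

Lemma sum_divisors (V : nmodType) (F : nat -> V) i : (0 < i)%N ->
  \sum_(d <- divisors i | odd d) F d = \sum_(d < i.+1 | (d %| i)%N && odd d) F d.
Proof.
move=> i0; rewrite -(big_mkord (fun d => (d %| i)%N && odd d)) /=.
rewrite -big_filter_cond; apply: perm_big; apply: uniq_perm.
- exact: divisors_uniq.
- by rewrite filter_uniq ?iota_uniq.
move=> d; rewrite -dvdn_divisors // mem_filter mem_index_iota /= ltnS.
by case: (boolP (d %| i)%N) => // /(dvdn_leq i0) ->.
Qed.

Lemma g_expE N l k i : (forall j, 0 < j <= N -> j %| l.+1)%N -> (0 < i <= N)%N ->
  g_exp i k = (nb_necklaces (2 * k) l i true)%:R.
Proof.
move=> dl iN; have /andP[i0 _] := iN.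
have i2 : (2 * i)%:R != 0 :> rat by rewrite pnatr_eq0 muln_eq0 /= -lt0n.
have := congr1 (fun z : int => z%:~R : rat) (nb_negativeE (2 * k) dl iN).
rewrite rmorph_nat mulnAC => E; apply: (mulfI i2); rewrite -natrM -E.
rewrite /g_exp mulVKf // sum_divisors // rmorph_sum /=.
apply: eq_bigr => d _; rewrite mul2n odd_double subr0 rmorphM /=.
by rewrite -natrX rmorph_nat.
Qed.

(** The term odd m = 1 of the inversion formula is weighted by the sum of
    the Moebius values over the odd divisors of i, which only survives for
    powers of 2. *)
Lemma h_expE N l k i : (forall j, 0 < j <= N -> j %| l.+1)%N -> (0 < i <= N)%N ->
  h_exp i k = (nb_necklaces (2 * k).+1 l i true)%:R.
Proof.
move=> dl iN; have /andP[i0 _] := iN.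
have i2 : (2 * i)%:R != 0 :> rat by rewrite pnatr_eq0 muln_eq0 /= -lt0n.
have := congr1 (fun z : int => z%:~R : rat) (nb_negativeE (2 * k).+1 dl iN).
rewrite rmorph_nat mulnAC => E; apply: (mulfI i2); rewrite -natrM -E.
under eq_bigr => d _ do rewrite mulrBr /= mul2n odd_double mulr1.
rewrite sumrB sum_moebius_odd // rmorphB rmorph_nat rmorph_sum /=.
under eq_bigr => d _ do rewrite rmorphM /= -natrX rmorph_nat.
rewrite /h_exp; case: (boolP (is_pow2 i)) => [|_]; last first.
  by rewrite mulVKf // sum_divisors // subr0 mul2n.
move=> /is_pow2P[j ij]; rewrite mulrC divfK // mul2n; congr (_ - _).
have odd1 d : (d %| i)%N && odd d = (d == 1%N).
  apply/andP/eqP => [[]|->]; last by rewrite dvd1n.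
  by rewrite ij => /dvdn_pfactor-/(_ isT)[[|e] _ ->] //; rewrite expnS oddM.
rewrite (big_pred1 (inord 1)) => [|d].
  by rewrite inordK // divn1 mul1r.
by rewrite /= odd1 -(inj_eq val_inj) /= inordK.
Qed.

(** * The necklace product *)

Section Congruence.
Variable R : comNzRingType.
Implicit Types f g : fps R.
Local Notation X := (fpsX R).

Definition eq_upto n f g := forall i, (i <= n)%N -> f i = g i.

Lemma eq_upto_refl n f : eq_upto n f f. Proof. by []. Qed.

Lemma eq_upto_trans n f g h : eq_upto n f g -> eq_upto n g h -> eq_upto n f h.
Proof. by move=> fg gh i ni; rewrite fg ?gh. Qed.

Lemma eq_upto_sym n f g : eq_upto n f g -> eq_upto n g f.
Proof. by move=> fg i ni; rewrite fg. Qed.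

Lemma eq_uptoM n f f' g g' : eq_upto n f f' -> eq_upto n g g' ->
  eq_upto n (f * g) (f' * g').
Proof.
move=> ff gg i ni; rewrite !coefM_fps; apply: eq_bigr => j _.
by rewrite ff ?gg ?(leq_trans _ ni) ?leq_subr // -ltnS.
Qed.

Lemma eq_uptoX n f f' k : eq_upto n f f' -> eq_upto n (f ^+ k) (f' ^+ k).
Proof.
by move=> ff; elim: k => [|k IH]; rewrite ?expr0 // !exprS; apply: eq_uptoM.
Qed.

Lemma eq_upto_prod n (I : Type) (r : seq I) (P : pred I) (F G : I -> fps R) :
  (forall i, P i -> eq_upto n (F i) (G i)) ->
  eq_upto n (\prod_(i <- r | P i) F i) (\prod_(i <- r | P i) G i).
Proof.
move=> FG; elim/big_rec2: _ => // i x y Pi xy.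
by apply: eq_uptoM => //; apply: FG.
Qed.

Lemma eq_upto_prod1 n (I : Type) (r : seq I) (P : pred I) (F : I -> fps R) :
  (forall i, P i -> eq_upto n (F i) 1) -> eq_upto n (\prod_(i <- r | P i) F i) 1.
Proof. by move/(eq_upto_prod r); rewrite big1_eq. Qed.

Lemma eq_upto_lcancel n h f g : h \is a GRing.unit ->
  eq_upto n (h * f) (h * g) -> eq_upto n f g.
Proof.
by move=> hU /(eq_uptoM (eq_upto_refl h^-1)); rewrite !mulKr.
Qed.

Lemma eq_uptoV n f g : f \is a GRing.unit -> g \is a GRing.unit ->
  eq_upto n f g -> eq_upto n f^-1 g^-1.
Proof.
move=> fU gU fg; apply: (eq_upto_lcancel fU); rewrite mulrV //.
by rewrite -(mulrV gU); apply: eq_uptoM => //; apply: eq_upto_sym.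
Qed.

Definition monom (c : R) k : fps R := fpsC c * X ^+ k.

Lemma coef_monom c k n : monom c k n = c *+ (n == k).
Proof.
rewrite coefCM_fps -[X ^+ k]mulr1 coefXnM_fps coef1_fps subn_eq0 -[RHS]mulr_natr.
by rewrite eqn_leq; case: (k <= n)%N; rewrite ?andbT ?andbF.
Qed.

Lemma monomM c k c' k' : monom c k * monom c' k' = monom (c * c') (k + k').
Proof. by rewrite /monom rmorphM exprD; ring. Qed.

Lemma monom_small n c k : (n < k)%N -> eq_upto n (monom c k) 0.
Proof. by move=> nk i ni; rewrite coef_monom ltn_eqF // (leq_ltn_trans ni). Qed.

Lemma monom_one_unit c k : (0 < k)%N -> 1 - monom c k \is a GRing.unit.
Proof.
move=> k0; apply: fps_unit_one; rewrite coefD_fps coefN_fps coef_monom.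
by rewrite ltn_eqF // subr0.
Qed.

Lemma one_plus_monom_small n c k : (n < k)%N -> eq_upto n (1 + monom c k) 1.
Proof. by move=> nk i ni; rewrite coefD_fps (monom_small c nk ni) addr0. Qed.

Lemma one_minus_monom_small n c k : (n < k)%N -> eq_upto n (1 - monom c k) 1.
Proof. by move=> nk i ni; rewrite coefD_fps coefN_fps (monom_small c nk ni) subr0. Qed.

Lemma inv_monom_small n c k : (n < k)%N -> eq_upto n (1 - monom c k)^-1 1.
Proof.
move=> nk; have U : 1 - monom c k \is a GRing.unit.
  by apply: monom_one_unit; apply: leq_ltn_trans nk.
have := eq_uptoV U (unitr1 _) (one_minus_monom_small c nk).
by rewrite invr1.
Qed.

Section NecklaceFactors.
Variable z : nat -> R.

Definition necklace_factor p (neg : bool) : fps R :=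
  if neg then (1 + monom (z p) p) / (1 - monom (z (2 * p)%N) (2 * p))
  else (1 - monom (z p) p)^-1.

Arguments necklace_factor : simpl never.

(** With b the monomial of the denominator, the terms of the sum satisfy t
    (c + 2) = b * t c for a negative necklace and t (c + 1) = b * t c for
    a positive one, so the product with 1 - b telescopes. What is left
    over has degree above n. *)
Lemma necklace_factor_sum n p neg : (0 < p)%N ->
  eq_upto n (\sum_(c < n.+1) monom (necklace_weight z p neg c) (p * c))
            (necklace_factor p neg).
Proof.
move=> p0; pose t c := monom (necklace_weight z p neg c) (p * c).
have t_small c : (n < c)%N -> eq_upto n (t c) 0.
  by move=> nc; apply: monom_small; apply: leq_trans nc _; rewrite leq_pmull.
rewrite /necklace_factor; case: neg @t t_small => t t_small.
  have U : 1 - monom (z (2 * p)%N) (2 * p) \is a GRing.unit.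
    by apply: monom_one_unit; rewrite muln_gt0.
  apply: (eq_upto_lcancel U); rewrite [X in eq_upto _ _ X]mulrC divrK //.
  have tS c : t c.+2 = monom (z (2 * p)%N) (2 * p) * t c.
    rewrite /t monomM /necklace_weight; congr monom; last by rewrite !mulnS addnA mul2n addnn.
    by rewrite /= negbK exprS; ring.
  have E K : (1 - monom (z (2 * p)%N) (2 * p)) * \sum_(c < K) t c + t K + t K.+1 =
      1 + monom (z p) p.
    elim: K => [|K <-].
      rewrite big_ord0 mulr0 add0r /t /necklace_weight /= muln0 muln1; congr (_ + _).
        by rewrite !expr0 mulr1 /monom rmorph1 expr0 mulr1.
      by rewrite expr1 expr0 mulr1.
    by rewrite big_ord_recr /= tS; ring.
  move=> i ni; rewrite -(E n.+1) 2!coefD_fps (t_small _ (ltnSn n) i ni).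
  by rewrite (t_small _ (ltnW (ltnSn n.+1)) i ni) !addr0.
have U := monom_one_unit (z p) p0.
apply: (eq_upto_lcancel U); rewrite mulrV //.
have tS c : t c.+1 = monom (z p) p * t c.
  by rewrite /t monomM /necklace_weight exprS mulnS.
have E K : (1 - monom (z p) p) * \sum_(c < K) t c + t K = 1.
  elim: K => [|K IH]; last by rewrite -[RHS]IH big_ord_recr /= tS; ring.
  by rewrite big_ord0 mulr0 add0r /t /necklace_weight muln0 expr0 /monom rmorph1 expr0 mulr1.
by move=> i ni; rewrite -[in RHS](E n.+1) coefD_fps (t_small _ (ltnSn n) i ni) addr0.
Qed.

Variables (n m l : nat).
Hypothesis dvd_fact : (n`! %| l.+1)%N.
Hypothesis dvd_length : forall i, (0 < i <= n.+1)%N -> (i %| l.+1)%N.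
Notation sigma := (rotation m l).
Notation necklaces := (porbits sigma).
Local Notation P p := (nb_necklaces m l p false).
Local Notation Q p := (nb_necklaces m l p true).

Lemma coef_necklace_product :
  (\prod_(O in necklaces) necklace_factor #|O| (negative_necklace O)) n =
  \sum_(s : 'S_n) \sum_(f : {ffun 'I_n -> 'I_m} | compat s f)
     \prod_(1 <= i < n.+1) z i ^+ ncycles s i.
Proof.
rewrite (sum_labelled_cycle_type m dvd_fact).
have E : eq_upto n (\prod_(O in necklaces) \sum_(c < n.+1)
      monom (necklace_weight z #|O| (negative_necklace O) c) (#|O| * c))
    (\prod_(O in necklaces) necklace_factor #|O| (negative_necklace O)).
  apply: eq_upto_prod => O /imsetP[v _ ->]; apply: necklace_factor_sum.
  by rewrite lt0n card_porbit_neq0.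
rewrite -E // (big_distr_big ord0) coef_sum_fps [RHS]big_mkcondr /=.
apply: eq_bigr => g _.
have -> : \prod_(O in necklaces)
    monom (necklace_weight z #|O| (negative_necklace O) (g O)) (#|O| * g O) =
  monom (\prod_(O in necklaces) necklace_weight z #|O| (negative_necklace O) (g O))
    (\sum_(O in necklaces) #|O| * g O).
  rewrite /monom rmorph_prod -prodrXr -big_split /=.
  by apply: eq_bigr.
by rewrite coef_monom eq_sym; case: eqP.
Qed.

(** Necklaces of length above n contribute factors congruent to 1. *)
Lemma necklace_product_by_length :
  eq_upto n (\prod_(O in necklaces) necklace_factor #|O| (negative_necklace O))
    (\prod_(1 <= p < n.+2) (necklace_factor p false ^+ P p * necklace_factor p true ^+ Q p)).
Proof.
(* Each necklace factor is written as a product over all lengths p, with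
   1 for the lengths that are not its own; exchanging products then
   groups the necklaces by length. *)
pose G p (O : {set {ffun 'I_l.+1 -> 'I_m}}) :=
  if #|O| == p then necklace_factor p (negative_necklace O) else 1.
apply: (@eq_upto_trans _ _ (\prod_(O in necklaces) \prod_(1 <= p < n.+2) G p O)).
  apply: eq_upto_prod => O /imsetP[v _ ->].
  set q := #|_|; have q0 : (0 < q)%N by rewrite lt0n card_porbit_neq0.
  have [qn|qn] := leqP q n.+1.
    rewrite (bigD1_seq q) ?mem_index_iota ?iota_uniq ?q0 ?ltnS //= /G eqxx.
    by rewrite big1 ?mulr1 // => i; rewrite eq_sym => /negbTE->.
  rewrite big1_seq => [|i]; last first.
    rewrite mem_index_iota ltnS /G => /and3P[_ _ iq]; by rewrite gtn_eqF // (leq_ltn_trans iq).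
  have nq : (n < q)%N by apply: ltn_trans qn.
  rewrite /necklace_factor; case: ifP => _; last exact: inv_monom_small.
  rewrite -[1 in X in eq_upto _ _ X]mulr1; apply: eq_uptoM; first exact: one_plus_monom_small.
  by apply: inv_monom_small; rewrite mul2n -addnn ltn_addl.
rewrite exchange_big; apply: eq_upto_prod => p _.
rewrite /G -big_mkcondr /= (bigID (fun O => negative_necklace O)) /= mulrC.
have E c : \prod_(O in necklaces | (#|O| == p) && (negative_necklace O == c))
    necklace_factor p (negative_necklace O) = necklace_factor p c ^+ nb_necklaces m l p c.
  rewrite (eq_bigr (fun=> necklace_factor p c)); last by move=> O /and3P[_ _ /eqP->].
  by rewrite prodr_const; congr (_ ^+ _); apply: eq_card => O; rewrite [RHS]inE.
rewrite -!E; move=> i _; congr (coefs (_ * _) i); apply: eq_bigl => O.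
  by rewrite eqbF_neg andbA.
by rewrite eqb_id andbA.
Qed.

(** The denominators 1 - z_{2p} x^{2p} of the negative necklaces of length
    p are regrouped with those of the positive necklaces of length 2p.
    Then nb_positiveE gives the numerator and the denominator of each
    length the same exponent, except for the length 1 when m is odd. *)
Lemma necklace_product :
  eq_upto n (\prod_(O in necklaces) necklace_factor #|O| (negative_necklace O))
    (\prod_(1 <= i < n.+2) ((1 + monom (z i) i) / (1 - monom (z i) i)) ^+ Q i
      * (1 - monom (z 1%N) 1)^-1 ^+ odd m).
Proof.
apply: eq_upto_trans necklace_product_by_length _.
pose D i := (1 - monom (z i) i)^-1; pose y i := 1 + monom (z i) i.
pose H i := if (2 %| i)%N then Q (i %/ 2)%N else 0%N.
have D2 : eq_upto n (\prod_(1 <= p < n.+2) D (2 * p)%N ^+ Q p)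
                    (\prod_(1 <= p < n.+2) D p ^+ H p).
  have from1 (F : nat -> fps R) : \prod_(1 <= p < n.+2) F p =
      \prod_(p < n.+2) (if (0 < p)%N then F p else 1).
    rewrite -(big_mkord xpredT (fun p => if (0 < p)%N then F p else 1)) [RHS]big_ltn //=.
    by rewrite mul1r big_nat [RHS]big_nat; apply: eq_bigr => i /andP[->].
  rewrite !from1.
  have -> : \prod_(p < n.+2) (if (0 < p)%N then D p ^+ H p else 1) =
      \prod_(p < n.+2 | (2 %| p)%N) (if (0 < p)%N then D p ^+ Q (p %/ 2)%N else 1).
    rewrite [RHS]big_mkcond; apply: eq_bigr => p _; rewrite /H.
    by case: ifP; case: ifP => //; rewrite expr0.
  rewrite (@big_multiples _ _ _ 2 n.+2 (fun p => if (0 < p)%N then D p ^+ Q (p %/ 2)%N else 1)) //.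
  rewrite [X in eq_upto _ _ X]big_mkcond; apply: eq_upto_prod => p _.
  rewrite muln_gt0 mulKn //=; case: (ltnP (2 * p) n.+2) => // lt_np.
  case: ifP => // _; rewrite -[1](expr1n _ (Q p)); apply: eq_uptoX.
  by apply: inv_monom_small; apply: leq_trans lt_np.
rewrite big_split /=.
have -> : \prod_(1 <= p < n.+2) necklace_factor p true ^+ Q p =
    \prod_(1 <= p < n.+2) y p ^+ Q p * \prod_(1 <= p < n.+2) D (2 * p)%N ^+ Q p.
  by rewrite -big_split; apply: eq_bigr => p _ /=; rewrite -exprMn.
apply: (@eq_upto_trans _ _ (\prod_(1 <= p < n.+2) D p ^+ P p *
  (\prod_(1 <= p < n.+2) y p ^+ Q p * \prod_(1 <= p < n.+2) D p ^+ H p))).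
  by do 2 apply: eq_uptoM => //.
rewrite mulrCA -big_split /=.
have -> : \prod_(1 <= i < n.+2) (D i ^+ P i * D i ^+ H i) =
    \prod_(1 <= i < n.+2) D i ^+ Q i * D 1%N ^+ odd m.
  have -> : D 1%N ^+ odd m = \prod_(1 <= i < n.+2) D i ^+ ((i == 1%N) * odd m).
    by rewrite big_ltn // eqxx mul1n big_nat big1 ?mulr1 // => i /andP[i1 _]; rewrite gtn_eqF.
  rewrite -big_split big_nat [RHS]big_nat; apply: eq_bigr => i iN /=.
  by rewrite -!exprD (nb_positiveE m dvd_length).
rewrite mulrA -big_split /=.
apply: eq_uptoM => //; apply: eq_upto_prod => i _.
by rewrite /= -exprMn.
Qed.

End NecklaceFactors.
End Congruence.

(** * Comparison of coefficients *)

Lemma run_series_ratio (R : comUnitRingType) (a d u t S T : R) (n c : nat) :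
  a \is a GRing.unit -> d \is a GRing.unit -> u \is a GRing.unit ->
  (2%:R : R) \is a GRing.unit ->
  a * S = t * T -> a * d ^+ n * T * u ^+ c = u ^+ n * (t *+ 2) ^+ c ->
  u ^+ n.+1 / (2%:R * a ^+ 2 * d ^+ n) * (2%:R * t / u) ^+ c.+1 = S.
Proof.
move=> aU dU uU tU aS adT; rewrite expr_div_n mulrACA.
have U1 : 2%:R * a ^+ 2 * d ^+ n \is a GRing.unit.
  by rewrite !unitrM tU aU unitrX.
have U2 : u ^+ c.+1 \is a GRing.unit by rewrite unitrX.
rewrite [X in _ * X]mulrC -invrM //; apply: (canLR (mulrK _)).
  by rewrite unitrM U1 U2.
have [w wE] : exists w, w = 2%:R * t by exists (2%:R * t).
rewrite -wE; rewrite -mulr_natl -wE in adT.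
rewrite (exprS u n) (exprS w c) (exprS u c).
transitivity (w * u * (u ^+ n * w ^+ c)); first by ring.
rewrite -adT [X in X * u * _]wE.
transitivity (2%:R * u * u ^+ c * (a * d ^+ n) * (t * T)); first by ring.
by rewrite -aS; ring.
Qed.

Lemma psring_coefP (R : comNzRingType) (f g : fps (fps R)) :
  (forall n k, f n k = g n k) -> f = g.
Proof. by move=> e; apply: fpsP => n; apply: fpsP. Qed.

Lemma pssum_coef (R : comNzRingType) b (u : nat -> fps (fps R)) n k c N :
  (forall M, (N <= M)%N -> \sum_(b <= i < M) u i n k = c) -> (pssum b u) n k = c.
Proof.
move=> H; apply: (@eventual_valueE _ _ _ _ N) => M NM.
by rewrite !coef_sum_fps H.
Qed.

Definition zvar (i : nat) : polyz := << 1 *g ucm i >>.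

(** The common coefficient of x^n t^k of the two sides. *)
Definition labelled_sum (n k : nat) : polyz :=
  \sum_(s : 'S_n) \sum_(f : {ffun 'I_n -> 'I_k} | compat s f)
    \prod_(1 <= i < n.+1) zvar i ^+ ncycles s i.

Lemma labelled_sum0 k : labelled_sum 0 k = 1.
Proof.
rewrite /labelled_sum (big_pred1 1%g) => [|s]; last first.
  by rewrite /=; apply/esym/eqP/permP; case.
pose f0 : {ffun 'I_0 -> 'I_k} := ffun0 (card_ord 0).
rewrite (big_pred1 f0) ?big_geq // => f /=.
rewrite [f == f0](introT eqP _); last by apply/ffunP; case.
by apply/compat_ltP; case.
Qed.

Lemma labelled_sumS n k : labelled_sum n.+1 k =
  \sum_(s : 'S_n.+1) labellings_series polyz (ascent s) n k *
    \prod_(1 <= i < n.+2) zvar i ^+ ncycles s i.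
Proof.
apply: eq_bigr => s _; rewrite /= -card_compat -sum1dep_card natr_sum mulr_suml.
by apply: eq_bigr => f _; rewrite mul1r.
Qed.

Lemma run_series n (s : 'S_n.+1) :
  (1 + ps_t ^+ 2) ^+ n.+1 / (2%:R * (1 - ps_t) ^+ 2 * (1 - ps_t ^+ 2) ^+ n)
    * (2%:R * ps_t / (1 + ps_t ^+ 2)) ^+ udr s =
  fpsC (labellings_series polyz (ascent s) n).
Proof.
have X2 k : (fpsX polyz ^+ 2) k = (k == 2)%:R.
  by have := coef_monom (1 : polyz) 2 k; rewrite /monom rmorph1 mul1r.
have unitC (f : fps polyz) : f 0%N = 1 -> fpsC f \is a @GRing.unit psring.
  by move=> f0; apply: (rmorph_unit (@fpsC (fps polyz))); apply: fps_unit_one.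
have tE : 1 - ps_t = fpsC (1 - fpsX polyz) by rewrite rmorphB rmorph1.
have t2E : 1 - ps_t ^+ 2 = fpsC (1 - fpsX polyz ^+ 2) by rewrite rmorphB rmorph1 rmorphXn.
have u2E : 1 + ps_t ^+ 2 = fpsC (1 + fpsX polyz ^+ 2) by rewrite rmorphD rmorph1 rmorphXn.
rewrite udrE; apply: (run_series_ratio (T := fpsC (label_series polyz (ascent s) n))).
- by rewrite tE; apply: unitC; rewrite coefD_fps coefN_fps /= subr0.
- by rewrite t2E; apply: unitC; rewrite coefD_fps coefN_fps X2 subr0.
- by rewrite u2E; apply: unitC; rewrite coefD_fps X2 addr0.
- exact: psring_natr_unit.
- by rewrite tE -rmorphM labellings_seriesE rmorphM.
rewrite tE t2E u2E -!rmorphXn -!rmorphM label_seriesE rmorphM !rmorphXn.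
by rewrite rmorphMn.
Qed.

Lemma Fudr_series n :
  (1 + ps_t ^+ 2) ^+ n.+1 / (2%:R * (1 - ps_t) ^+ 2 * (1 - ps_t ^+ 2) ^+ n)
    * Fudr n.+1 (2%:R * ps_t / (1 + ps_t ^+ 2)) ps_z =
  fpsC (FPS (labelled_sum n.+1)).
Proof.
have run := @run_series n; move: run; rewrite /Fudr.
move: (_ / _) (_ / _) => K r run; rewrite mulr_sumr.
transitivity (fpsC (\sum_(s : 'S_n.+1) fpsC (\prod_(1 <= i < n.+2) zvar i ^+ ncycles s i) *
   labellings_series polyz (ascent s) n)).
  rewrite [RHS]rmorph_sum; apply: eq_bigr => s _.
  rewrite [LHS]mulrA run mulrC [RHS]rmorphM; congr (_ * _).
  rewrite [in RHS]rmorph_prod [RHS]rmorph_prod; apply: eq_bigr => i _.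
  by rewrite [in RHS]rmorphXn [RHS]rmorphXn.
congr fpsC; apply: fpsP => k; rewrite coef_sum_fps [RHS]labelled_sumS.
by apply: eq_bigr => s _; rewrite coefCM_fps mulrC.
Qed.

(** The exponents are natural numbers, so the powers are ordinary ones,
    and the factors with i > n are congruent to 1: the coefficients of the
    partial products are constant from n + 2 on. *)
Lemma psprod_necklaces (n : nat) (e : nat -> rat) (q : nat -> nat) :
  (forall i, (0 < i <= n.+1)%N -> e i = (q i)%:R) ->
  (forall i, (0 < i)%N -> exists q', e i = q'%:R) ->
  eq_upto n
    (\prodoo_(1 <= i) pspow ((1 + ps_z i * ps_x ^+ i) / (1 - ps_z i * ps_x ^+ i)) (e i))
    (\prod_(1 <= i < n.+2)
       ((1 + monom (fpsC (zvar i)) i) / (1 - monom (fpsC (zvar i)) i)) ^+ q i).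
Proof.
move=> eq eN; set F := fun i => pspow _ _.
have F_small i : (n < i)%N -> eq_upto n (F i) 1.
  move=> ni; rewrite /F; have [q' ->] := eN i (leq_ltn_trans (leq0n n) ni); rewrite pspow_nat.
  apply: (@eq_upto_trans _ _ _ (1 ^+ q')); last by rewrite expr1n.
  apply: eq_uptoX; apply: (@eq_upto_trans _ _ _ (1 * 1)); last by rewrite mulr1.
  apply: eq_uptoM; first exact: (@one_plus_monom_small _ n (fpsC (zvar i)) i ni).
  exact: inv_monom_small.
pose G i := ((1 + monom (fpsC (zvar i)) i) / (1 - monom (fpsC (zvar i)) i)) ^+ q i.
have E M : (n.+2 <= M)%N -> eq_upto n (\prod_(1 <= i < M) F i) (\prod_(1 <= i < n.+2) G i).
  move=> nM; rewrite (big_cat_nat _ nM) //= -[X in eq_upto _ _ X]mulr1.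
  apply: eq_uptoM; last first.
    rewrite big_nat; apply: eq_upto_prod1 => i /andP[ni _]; apply: F_small.
    exact: leq_trans ni.
  rewrite big_nat [X in eq_upto _ _ X]big_nat; apply: eq_upto_prod => i iN.
  by rewrite /F eq // pspow_nat.
move=> i ni; apply: fpsP => j; apply: (@eventual_valueE _ _ _ _ n.+2) => M nM.
by rewrite (E M nM i ni).
Qed.

Lemma coef_psprod (m n k : nat) (e : nat -> rat) :
  (forall N l i, (forall j, 0 < j <= N -> j %| l.+1)%N -> (0 < i <= N)%N ->
    e i = (nb_necklaces m l i true)%:R) ->
  (ps_t ^+ m / (1 - ps_z 1 * ps_x) ^+ odd m *
    \prodoo_(1 <= i) pspow ((1 + ps_z i * ps_x ^+ i) / (1 - ps_z i * ps_x ^+ i)) (e i)) n k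
  = if k == m then labelled_sum n m else 0.
Proof.
(* The word length (n + 1)! is a multiple of all lengths up to n + 1 and
   of the order of every permutation of n points; length 1 is thus
   available even for n = 0. *)
move=> eE; pose l := (n.+1`!).-1.
have l1 : l.+1 = n.+1`! by rewrite /l prednK ?fact_gt0.
have dvd_length j : (0 < j <= n.+1)%N -> (j %| l.+1)%N.
  by move=> jn; rewrite l1 dvdn_fact.
have dvd_fact : (n`! %| l.+1)%N by rewrite l1 factS dvdn_mull.
have eN i : (0 < i)%N -> exists q', e i = q'%:R.
  move=> i0; exists (nb_necklaces m (i`!).-1 i true); apply: (eE i) => [j ji|].
    by rewrite prednK ?fact_gt0 // dvdn_fact.
  by rewrite i0 leqnn.
pose z i := fpsC (zvar i); pose inv1 : psring := (1 - monom (z 1%N) 1)^-1.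
set pr := \prodoo_(1 <= i) _.
have E : eq_upto n (inv1 ^+ odd m * pr)
    (\prod_(O in porbits (rotation m l)) necklace_factor z #|O| (negative_necklace O)).
  apply: eq_upto_sym; apply: eq_upto_trans (necklace_product z m dvd_length) _.
  rewrite [X in eq_upto _ X _]mulrC; apply: eq_uptoM => //; apply: eq_upto_sym.
  apply: (@psprod_necklaces n e (fun i => nb_necklaces m l i true)) => // i iN.
  exact: (eE n.+1).
have -> : ps_t ^+ m / (1 - ps_z 1 * ps_x) ^+ odd m * pr =
    fpsC (fpsX polyz ^+ m) * (inv1 ^+ odd m * pr).
  by rewrite rmorphXn mulrA exprVn.
rewrite coefCM_fps E // coef_necklace_product //.
have -> : \sum_(s : 'S_n) \sum_(f : {ffun 'I_n -> 'I_m} | compat s f)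
    \prod_(1 <= i < n.+1) z i ^+ ncycles s i = fpsC (labelled_sum n m).
  rewrite [RHS]rmorph_sum; apply: eq_bigr => s _; rewrite [RHS]rmorph_sum.
  apply: eq_bigr => f _; rewrite [RHS]rmorph_prod; apply: eq_bigr => i _.
  by rewrite [RHS]rmorphXn.
rewrite coefXnM_fps /= subn_eq0 eqn_leq andbC.
by case: (m <= k)%N.
Qed.

Lemma g_series k n j :
  (ps_t ^+ (2 * k) *
   \prodoo_(1 <= i) pspow ((1 + ps_z i * ps_x ^+ i) / (1 - ps_z i * ps_x ^+ i)) (g_exp i k))
    n j = if j == (2 * k)%N then labelled_sum n (2 * k) else 0.
Proof.
rewrite -(@coef_psprod _ n j (g_exp^~ k)) => [|N l i]; last exact: g_expE.
by rewrite mul2n odd_double expr0 divr1.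
Qed.

Lemma h_series k n j :
  (ps_t ^+ (2 * k).+1 / (1 - ps_z 1 * ps_x) *
   \prodoo_(1 <= i) pspow ((1 + ps_z i * ps_x ^+ i) / (1 - ps_z i * ps_x ^+ i)) (h_exp i k))
    n j = if j == (2 * k).+1 then labelled_sum n (2 * k).+1 else 0.
Proof.
rewrite -(@coef_psprod _ n j (h_exp^~ k)) => [|N l i]; last exact: h_expE.
by rewrite /= mul2n odd_double expr1.
Qed.

Lemma geometric_coef n j : ((1 - ps_t)^-1) n j = (n == 0%N)%:R.
Proof.
rewrite (mulr1_eq (_ : (1 - ps_t) * fpsC (FPS (fun=> 1)) = 1)).
  by case: n.
have -> : 1 - ps_t = fpsC (1 - fpsX polyz) by rewrite rmorphB rmorph1.
rewrite -rmorphM -[RHS](rmorph1 (@fpsC (fps polyz))); congr fpsC; apply: fpsP => k.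
rewrite mulrBl mul1r coefD_fps coefN_fps coefXM_fps coef1_fps.
by case: k => [|k]; rewrite ?subr0 ?subrr.
Qed.

Lemma run_term i n j : (0 < i)%N ->
  ((1 + ps_t ^+ 2) ^+ i / (2%:R * (1 - ps_t) ^+ 2 * (1 - ps_t ^+ 2) ^+ i.-1)
    * Fudr i (2%:R * ps_t / (1 + ps_t ^+ 2)) ps_z * ps_x ^+ i) n j =
  if i == n then labelled_sum n j else 0.
Proof.
case: i => // i _; have mulx (f g : psring) : f = g ->
    (f * ps_x ^+ i.+1) n j = (g * ps_x ^+ i.+1) n j by move->.
apply: etrans (mulx _ _ (Fudr_series i)) _.
have -> := coef_monom (FPS (labelled_sum i.+1)) i.+1 n; rewrite eq_sym.
by case: eqP => [->|_].
Qed.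

Lemma sum_nat_pred1 (V : nmodType) b M q (c : V) :
  \sum_(b <= i < M) (if i == q then c else 0) = if (b <= q < M)%N then c else 0.
Proof.
rewrite -mem_index_iota; case: ifP => qM.
  rewrite (bigD1_seq q) ?iota_uniq //= eqxx big1 ?addr0 // => i /negbTE.
  by move->.
by rewrite big1_seq // => i /andP[_ iM]; case: eqP => // iq; rewrite -iq iM in qM.
Qed.

Theorem theorem7p3 :
  let x := ps_x in
  let t := ps_t in
  let z := ps_z in
  (1 - t)^-1
  + \sumoo_(1 <= n)
      (((1 + t ^+ 2) ^+ n / (2%:R * (1 - t) ^+ 2 * (1 - t ^+ 2) ^+ n.-1))
       * Fudr n (2%:R * t / (1 + t ^+ 2)) z * x ^+ n)
  = \sumoo_(0 <= k)
      (t ^+ (2 * k) *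
       \prodoo_(1 <= i)
         pspow ((1 + z i * x ^+ i) / (1 - z i * x ^+ i)) (g_exp i k))
    + \sumoo_(0 <= k)
        (t ^+ (2 * k).+1 / (1 - z 1%N * x) *
         \prodoo_(1 <= i)
           pspow ((1 + z i * x ^+ i) / (1 - z i * x ^+ i)) (h_exp i k)).
Proof.
move=> x t z; apply: psring_coefP => n j.
have coefD (f g : psring) : (f + g) n j = f n j + g n j by [].
have addE (a b a' b' : polyz) : a = a' -> b = b' -> a + b = a' + b' by move=> -> ->.
have half_le : (j./2 <= j)%N by rewrite -{2}[j]odd_double_half -addnn addnA leq_addl.
rewrite [LHS]coefD [RHS]coefD.
transitivity ((n == 0%N)%:R + (if (0 < n)%N then labelled_sum n j else 0)).
  apply: addE; first exact: geometric_coef.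
  apply: (@pssum_coef _ _ _ _ _ _ n.+1) => M nM.
  transitivity (\sum_(1 <= i < M) (if i == n then labelled_sum n j else 0)).
    by rewrite big_nat [RHS]big_nat; apply: eq_bigr => i /andP[i0 _]; apply: run_term.
  by rewrite sum_nat_pred1 nM andbT.
transitivity ((if odd j then 0 else labelled_sum n j) +
              (if odd j then labelled_sum n j else 0)).
  have -> : (n == 0%N)%:R + (if (0 < n)%N then labelled_sum n j else 0) = labelled_sum n j.
    by clear; case: n => [|n]; rewrite ?labelled_sum0 ?addr0 ?add0r.
  by case: odd; rewrite ?add0r ?addr0.
apply/esym/addE.
  apply: (@pssum_coef _ _ _ _ _ _ j.+1) => M jM.
  transitivity (\sum_(0 <= k < M)
      (if k == j./2 then if odd j then 0 else labelled_sum n j else 0)).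
    apply: eq_bigr => k _; apply: etrans (g_series k n j) _; rewrite mul2n.
    case: eqP => [->|nj]; first by rewrite doubleK eqxx odd_double.
    case: eqP => // kj; case: (boolP (odd j)) => // oj.
    by case: nj; rewrite kj -[LHS]odd_double_half (negbTE oj).
  by rewrite sum_nat_pred1 (leq_ltn_trans half_le jM).
apply: (@pssum_coef _ _ _ _ _ _ j.+1) => M jM.
transitivity (\sum_(0 <= k < M)
    (if k == j./2 then if odd j then labelled_sum n j else 0 else 0)).
  apply: eq_bigr => k _; apply: etrans (h_series k n j) _; rewrite mul2n.
  case: eqP => [->|nj]; first by rewrite /= uphalf_double eqxx odd_double.
  case: eqP => // kj; case: (boolP (odd j)) => // oj.
  by case: nj; rewrite kj -[LHS]odd_double_half oj.
by rewrite sum_nat_pred1 (leq_ltn_trans half_le jM).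
Qed.
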